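(* Let $\|\cdot\|_F$ be an arbitrary norm on $\mathbb{R}^2$ and let $\varepsilon>0$. Then \[ \chi_{[1-\varepsilon,1+\varepsilon]}(\mathbb{R}^2;F)\ \geq\ 7 . \] That is, for every partition $\mathbb{R}^2=M_1\sqcup\dots\sqcup M_6$ of the plane into $6$ sets, some $M_i$ contains two points $x,y$ with $\|x-y\|_F\in[1-\varepsilon,1+\varepsilon]$.
   Context: For a norm $\|\cdot\|_F$ on $\mathbb{R}^2$ (with unit ball $F=\{x:\|x\|_F\le 1\}$), a set $A\subseteq\mathbb{R}^2$ and a set of forbidden distances $\mathcal{D}\subset\mathbb{R}_+$, the chromatic number $\chi_{\mathcal{D}}(A;F)$ is the least natural number $k$ such that there is a map $\varphi:A\to\{1,\dots,k\}$ with $\varphi(x)\neq\varphi(y)$ whenever $x,y\in A$ and $\|x-y\|_F\in\mathcal{D}$. No regularity (measurability etc.) is imposed on the coloring. *)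

(* Defs.v *)
From HB Require Import structures.
From mathcomp Require Import all_boot all_order all_algebra.
From mathcomp Require Import all_classical all_reals all_analysis.
Set Implicit Arguments.
Unset Strict Implicit.
Unset Printing Implicit Defensive.
Import Order.TTheory GRing.Theory Num.Theory.

Local Open Scope classical_set_scope.
Local Open Scope ring_scope.

(* The axioms are those of the library's factory [Lmodule_isNormed], stated for
   a bare function because 'rV[R]_2 already carries the canonical sup norm. *)
Record is_norm (R : realType) (V : lmodType R) (N : V -> R) : Prop := IsNorm {
  is_norm_triangle : forall x y : V, N (x + y) <= N x + N y;
  is_norm_homogeneous : forall (a : R) (x : V), N (a *: x) = `|a| * N x;
  is_norm_definite : forall x : V, N x = 0 -> x = 0
}.

Definition proper_coloring (R : realType) (V : lmodType R) (N : V -> R)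
    (D : set R) (A : set V) (k : nat) (phi : A -> 'I_k) : Prop :=
  forall x y : A, D (N (set_val x - set_val y)) -> phi x <> phi y.

Definition colorable (R : realType) (V : lmodType R) (N : V -> R)
    (D : set R) (A : set V) (k : nat) : Prop :=
  exists phi : A -> 'I_k, proper_coloring N D phi.

(* Valued in \bar R so that it is +oo exactly when no finite number of colors
   suffices; otherwise the infimum, taken over a nonempty set of naturals, is
   its least element. *)
Definition chromatic_number (R : realType) (V : lmodType R) (N : V -> R)
    (D : set R) (A : set V) : \bar R :=
  ereal_inf [set (k%:R)%:E | k in [set k | colorable N D A k]].

(* Main.v *)
(* Suppose that six colors suffice; choose coordinates in which (1, 0), (0, 1)
   and (-1, 1) are unit vectors, and a fine triangular lattice. If two
   trichromatic lattice triangles carry complementary color triples then their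
   distance exceeds 2, since a point at distance 1 from both would have no color.
   Hence at most two colors meet locally on the unit circle around a trichromatic
   triangle, so that the changes of color form a mod 2 cocycle on this circle. Its
   class is not zero: a potential would fix the colors of a turning inscribed
   hexagon. It follows that the unit ball around a trichromatic triangle contains
   an odd number of trichromatic triangles.
   Count them mod 2 by color triples. Stokes' formula for the edges of two given
   colors gives linear relations between these parities, and pairing the
   triangles that are joined by a chain crossing edges of two given colors shows
   that the parities of too many triples vanish. So no triangle is trichromatic.
   But monochromatic components have diameter less than 1, and Sperner's lemma,
   with labels constant on components, produces a trichromatic triangle. *)
Require Import Defs.
From HB Require Import structures.
From mathcomp Require Import all_boot all_order all_algebra.
From mathcomp Require Import all_classical all_reals all_analysis.
From mathcomp Require Import ring lra zify.
Set Implicit Arguments.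
Unset Strict Implicit.
Unset Printing Implicit Defensive.
Import Order.TTheory GRing.Theory Num.Theory.
Import numFieldNormedType.Exports.

Local Open Scope classical_set_scope.
Local Open Scope ring_scope.

(** * Norms on a real vector space *)

Section RealLine.
Variable R : realType.

(** The coloring has no regularity, so all topology is done on the lattice, and eps is the slack
    that lets a small triangle stand for a point. Every count rests on one principle: a vertex of
    color c is never at a distance within eps of 1 from a point of color c. Hence a triangle with a
    vertex of color c stays on its side of the unit circle while the center moves in small steps
    through points of color c, and parities in unit balls can be compared at distant triangles. This
    comparison is needed because the relations at one triangle are consistent: at a triangle of
    colors a, b, c they still allow exactly ade, adf and aef to be odd. The contradiction comes from
    transporting parities along chains of triangles and monochromatic paths. Since the norm may be
    neither smooth nor strictly convex, circles and hexagons are handled with explicit Lipschitz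
    constants, which the inscribed hexagon of the chosen coordinates supplies. *)

Lemma lipschitz_IVT (f : R -> R) (L v : R) :
  (forall s t, 0 <= s <= 1 -> 0 <= t <= 1 -> `|f s - f t| <= L * `|s - t|) ->
  f 0 <= v <= f 1 -> exists2 c, 0 <= c <= 1 & f c = v.
Proof.
move=> fL /andP[f0v vf1].
(* [IVT] asks for continuity, while [f] is controlled on [0, 1] only; it is extended by
   constants. *)
pose clamp (s : R) := if s < 0 then 0 else if s < 1 then s else 1.
have clamp01 s : 0 <= clamp s <= 1.
  by rewrite /clamp; case: ltP => ?; [|case: ltP => ?]; lra.
have clampL s t : `|clamp s - clamp t| <= `|s - t|.
  wlog st : s t / t <= s => [th|].
    have [/th//|/ltW/th] := leP t s; by rewrite distrC (distrC t).
  rewrite (@ger0_norm _ (s - t)) ?subr_ge0// ler_norml /clamp {fL f0v vf1}.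
  by case: (ltP s 0) => ?; case: (ltP s 1) => ?; case: (ltP t 0) => ?;
    case: (ltP t 1) => ?; apply/andP; split; lra.
have fc : continuous (f \o clamp).
  move=> x; apply/cvgrPdist_lt => e e0.
  have L1 : 0 < `|L| + 1 by apply: ltr_wpDl.
  near=> t; apply: le_lt_trans (fL _ _ (clamp01 _) (clamp01 _)) _.
  have xt : `|x - t| < e / (`|L| + 1).
    by near: t; apply: cvgr_dist_lt; rewrite ?divr_gt0.
  have : L * `|clamp x - clamp t| <= (`|L| + 1) * `|x - t|.
    apply: le_trans (_ : (`|L| + 1) * `|clamp x - clamp t| <= _).
      by apply: ler_wpM2r => //; have := ler_norm L; lra.
    by rewrite ler_wpM2l// ltW.
  by move=> /le_lt_trans; apply; rewrite mulrC -ltr_pdivlMr.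
have [||c] := @IVT R (f \o clamp) 0 1 v ler01.
- exact: continuous_subspaceT.
- by rewrite /= /clamp ltxx ltr01 ltxx ltr10 ge_min f0v le_max vf1 orbT.
by rewrite in_itv /= => c01 <-; exists (clamp c).
Unshelve. all: by end_near.
Qed.

(* Invariance along a unit interval of a property that persists under small
   steps. *)
Lemma unit_interval_transport (P : R -> Prop) (r : R) : 0 < r ->
  (forall s t, 0 <= s <= 1 -> 0 <= t <= 1 -> `|s - t| <= r -> P s -> P t) ->
  P 0 -> P 1.
Proof.
move=> r0 step P0.
have [n nr] : exists n : nat, r^-1 < n.+1%:R.
  exists (Num.bound r^-1); rewrite (lt_le_trans (archi_boundP _)) ?ler_nat//.
  by rewrite invr_ge0 ltW.
have n1 : (0 : R) < n.+1%:R by rewrite ltr0n.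
suff H k : (k <= n.+1)%N -> P (k%:R / n.+1%:R).
  by have := H n.+1 (leqnn _); rewrite divff// gt_eqF.
elim: k => [|k IH kn]; first by rewrite mul0r.
have b j : (j <= n.+1)%N -> 0 <= (j%:R / n.+1%:R : R) <= 1.
  by move=> jn; rewrite divr_ge0//= ler_pdivrMr// mul1r ler_nat.
apply: step (IH (ltnW kn)); [exact: b (ltnW kn)|exact: b|].
rewrite -mulrBl -natr1 opprD addNKr mulN1r normrN ger0_norm ?invr_ge0 ?ltW//.
by rewrite invf_plt ?posrE.
Qed.

End RealLine.

Section NormTheory.
Variables (R : realType) (V : lmodType R) (N : V -> R).
Hypothesis hN : is_norm N.
Implicit Types (x y z : V) (a : R).

Let ND := is_norm_triangle hN.
Let NZ := is_norm_homogeneous hN.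

Lemma is_norm0 : N 0 = 0.
Proof. by rewrite -(scale0r (0 : V)) NZ normr0 mul0r. Qed.

Lemma is_normN x : N (- x) = N x.
Proof. by rewrite -scaleN1r NZ normrN normr1 mul1r. Qed.

Lemma is_normBC x y : N (x - y) = N (y - x).
Proof. by rewrite -is_normN opprB. Qed.

Lemma is_norm_ge0 x : 0 <= N x.
Proof. by have := ND x (- x); rewrite subrr is_norm0 is_normN; lra. Qed.

Lemma is_norm_gt0 x : x != 0 -> 0 < N x.
Proof.
move=> x0; rewrite lt_neqAle is_norm_ge0 andbT eq_sym.
by apply: contra x0 => /eqP /(is_norm_definite hN) ->.
Qed.

Lemma is_normB x y : N (x - y) <= N x + N y.
Proof. by rewrite -(is_normN y) ND. Qed.

Lemma is_norm_dist y x z : N (x - z) <= N (x - y) + N (y - z).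
Proof. by rewrite -{1}(subrK y x) -addrA ND. Qed.

Lemma is_norm_leB x y : N x - N y <= N (x - y).
Proof. by rewrite lerBlDr -{1}(subrK y x) ND. Qed.

Lemma is_norm_lip x y : `|N x - N y| <= N (x - y).
Proof.
rewrite ler_norml is_norm_leB andbT.
by have := is_norm_leB y x; rewrite is_normBC; lra.
Qed.

Lemma is_normZ_ge0 a x : 0 <= a -> N (a *: x) = a * N x.
Proof. by move=> a0; rewrite NZ ger0_norm. Qed.

Definition unit_of x := (N x)^-1 *: x.

Lemma unit_of_norm x : 0 < N x -> N (unit_of x) = 1.
Proof. by move=> x0; rewrite is_normZ_ge0 ?invr_ge0 ?ltW// mulVf ?gt_eqF. Qed.

Lemma unit_of_id x : N x = 1 -> unit_of x = x.
Proof. by rewrite /unit_of => ->; rewrite invr1 scale1r. Qed.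

Lemma unit_ofK x : 0 < N x -> x = N x *: unit_of x.
Proof. by move=> x0; rewrite scalerA divff ?scale1r// gt_eqF. Qed.

Lemma dist_unit_of x : 0 < N x -> N (unit_of x - x) = `|1 - N x|.
Proof.
move=> x0; rewrite {2}(unit_ofK x0) -{1}(scale1r (unit_of x)) -scalerBl NZ.
by rewrite unit_of_norm// mulr1.
Qed.

Lemma unit_of_lip x y : 0 < N x -> 0 < N y ->
  N (unit_of x - unit_of y) <= 2 / N x * N (x - y).
Proof.
move=> x0 y0.
have -> : unit_of x - unit_of y =
    (N x)^-1 *: (x - y) + ((N x)^-1 * (N y - N x)) *: unit_of y.
  rewrite mulrBr mulVf ?gt_eqF// scalerBl scale1r scalerBr -scalerA -unit_ofK//.
  by rewrite addrA addrNK.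
apply: le_trans (ND _ _) _; rewrite NZ (NZ _ (unit_of y)) unit_of_norm// mulr1.
rewrite normrM.
rewrite ger0_norm ?invr_ge0 ?(ltW x0)//.
have : (N x)^-1 * `|N y - N x| <= (N x)^-1 * N (x - y).
  by rewrite ler_wpM2l ?invr_ge0 ?(ltW x0)// (is_normBC x) is_norm_lip.
lra.
Qed.

(* In the quadrilateral with vertices 0, x, y, y' the diagonals meet, at the
   point c below, because y has norm at least that of its projection on the
   chord. *)
Lemma quadrilateral x y y' a b : 0 <= a -> 0 <= b -> y = a *: x + b *: y' ->
  N x = 1 -> N y = 1 -> N y' = 1 -> N (y - x) <= N (y' - x).
Proof.
move=> a0 b0 yE x1 y1 y'1.
have ab1 : 1 <= a + b.
  by have := ND (a *: x) (b *: y'); rewrite -yE !is_normZ_ge0// x1 y1 y'1; lra.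
have s0 : 0 < a + b by lra.
pose c := (a + b)^-1 *: y.
have Nyc : N (y - c) = 1 - (a + b)^-1.
  rewrite -{1}(scale1r y) -scalerBl is_normZ_ge0 ?y1 ?mulr1//.
  by rewrite subr_ge0 invf_le1.
have Nc : N c = (a + b)^-1 by rewrite is_normZ_ge0 ?y1 ?mulr1// invr_ge0 ltW.
have s1 : (a + b)^-1 * a + (a + b)^-1 * b = 1 by rewrite -mulrDr mulVf// gt_eqF.
have cE : c = ((a + b)^-1 * a) *: x + ((a + b)^-1 * b) *: y'.
  by rewrite /c yE scalerDr !scalerA.
have cx : c - x = ((a + b)^-1 * b) *: (y' - x).
  rewrite cE -{2}(scale1r x) -s1 scalerDl scalerBr opprD addrACA.
  by rewrite subrr add0r.
have y'c : y' - c = ((a + b)^-1 * a) *: (y' - x).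
  rewrite cE -{1}(scale1r y') -s1 scalerDl scalerBr opprD addrACA subrr addr0.
  by [].
have i0 : 0 <= (a + b)^-1 by rewrite invr_ge0 ltW.
have Ncx : N (c - x) = (a + b)^-1 * b * N (y' - x).
  by rewrite cx is_normZ_ge0// mulr_ge0.
have Ny'c : N (y' - c) = (a + b)^-1 * a * N (y' - x).
  by rewrite y'c is_normZ_ge0// mulr_ge0.
have /= h1 := is_norm_dist c y x.
have /= h2 := is_norm_leB y' c.
have : N (c - x) + N (y' - c) = N (y' - x).
  by rewrite Ncx Ny'c -mulrDl addrC s1 mul1r.
lra.
Qed.

(* Unit circles whose centres are at distance at most 2 meet: the distance to q
   passes through 1 along a half circle from q / N q to its opposite, here
   obtained by normalizing a parabola through these two points. *)
Lemma unit_circles_meet (q w : V) :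
  w != 0 -> (q != 0 -> forall s t : R, s *: q + t *: w = 0 -> s = 0 /\ t = 0) ->
  N q <= 2 -> exists2 y, N y = 1 & N (y - q) = 1.
Proof.
move=> w0 ind q2.
have [q0|q0] := eqVneq q 0.
  exists (unit_of w); first by rewrite unit_of_norm ?is_norm_gt0.
  by rewrite q0 subr0 unit_of_norm ?is_norm_gt0.
have Nq := is_norm_gt0 q0.
pose u := unit_of q.
have Nu : N u = 1 by rewrite unit_of_norm.
pose v (s : R) : V := (1 - 2 * s) *: u + (s * (1 - s)) *: w.
(* This is [N (v s)] times the excess over 1 of the distance from [unit_of (v s)] to [q]; without
   the division the Lipschitz bound is direct. *)
pose f s := N (v s - N (v s) *: q) - N (v s).
have v0 s : 0 < N (v s).
  apply: is_norm_gt0; apply/eqP; rewrite /v /u /unit_of scalerA.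
  move=> /(ind q0)[/eqP]; rewrite mulf_eq0 invr_eq0 (gt_eqF Nq) orbF subr_eq0.
  move=> /eqP e1 /eqP; rewrite mulf_eq0 => /orP[/eqP e2|/eqP e2]; lra.
have vL s t : 0 <= s <= 1 -> 0 <= t <= 1 ->
    N (v s - v t) <= (2 + N w) * `|s - t|.
  move=> s01 t01.
  have -> : v s - v t = (- (2 * (s - t))) *: u + ((s - t) * (1 - s - t)) *: w.
    rewrite /v opprD addrACA -!scalerBl; congr (_ *: _ + _ *: _); ring.
  apply: le_trans (ND _ _) _; rewrite (NZ _ u) (NZ _ w) Nu normrN !normrM.
  rewrite (ger0_norm (ler0n _ 2)).
  have : `|s - t| * `|1 - s - t| * N w <= `|s - t| * N w.
    by rewrite ler_wpM2r ?is_norm_ge0// ler_piMr// ler_norml; lra.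
  lra.
have f01 : f 0 <= 0 <= f 1.
  have v00 : v 0 = u by rewrite /v mulr0 subr0 scale1r mul0r scale0r addr0.
  have v1 : v 1 = - u.
    rewrite /v subrr mulr0 scale0r addr0 mulr1.
    by rewrite (_ : 1 - 2 = -1) ?scaleN1r//; ring.
  have Nuq : N (u - q) = `|1 - N q| by rewrite dist_unit_of.
  have Nuq' : N (u + q) = 1 + N q.
    have -> : u + q = (1 + N q) *: u by rewrite scalerDl scale1r -unit_ofK.
    by rewrite is_normZ_ge0 ?Nu ?mulr1// addr_ge0// ltW.
  rewrite /f v00 v1 is_normN Nu scale1r Nuq -opprD is_normN Nuq'.
  by apply/andP; split; [rewrite subr_le0 ler_norml|]; lra.
have [|c c01 fc] := @lipschitz_IVT R f ((2 + N q) * (2 + N w)) 0 _ f01.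
  move=> s t s01 t01.
  have h := is_norm_lip (v s) (v t).
  have h' := is_norm_lip (v s - N (v s) *: q) (v t - N (v t) *: q).
  have h2 : N (v s - N (v s) *: q - (v t - N (v t) *: q)) <=
            N (v s - v t) + N (v s - v t) * N q.
    have -> : v s - N (v s) *: q - (v t - N (v t) *: q) =
              (v s - v t) + (N (v t) - N (v s)) *: q.
      by rewrite scalerBl opprB addrACA [RHS]addrACA [- (_ *: _) - v t]addrC.
    apply: le_trans (ND _ _) _; rewrite lerD2l NZ distrC.
    by rewrite ler_wpM2r ?is_norm_ge0.
  have h3 := vL s t s01 t01.
  have : `|f s - f t| <= (2 + N q) * N (v s - v t).
    apply: le_trans (_ : _ <= `|N (v s - N (v s) *: q) - N (v t - N (v t) *: q)|
                              + `|N (v s) - N (v t)|) _.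
      by apply: le_trans (ler_normB _ _); rewrite le_eqVlt /f; apply/orP; left;
        apply/eqP; congr `|_|; ring.
    lra.
  by move=> /le_trans; apply; rewrite -mulrA ler_wpM2l// addr_ge0// ltW.
exists (unit_of (v c)); first exact: unit_of_norm.
have -> : unit_of (v c) - q = (N (v c))^-1 *: (v c - N (v c) *: q).
  by rewrite scalerBr scalerA mulVf ?gt_eqF// scale1r.
rewrite is_normZ_ge0 ?invr_ge0 ?ltW//; move: fc => /eqP; rewrite subr_eq0.
by move=> /eqP ->; rewrite mulVf// gt_eqF.
Qed.

End NormTheory.

(** * The unit circle of a planar norm *)

Lemma opposite_signs_small (R : realType) (a b t : R) : `|a - b| <= t ->
  (a < 0) != (b < 0) -> `|a| <= t /\ `|b| <= t.
Proof.
rewrite ler_norml => /andP[h1 h2].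
by case: (ltrP a 0) => ha; case: (ltrP b 0) => hb // _;
  split; rewrite ler_norml; apply/andP; split; lra.
Qed.
Lemma far_same_sign (R : realType) (c d t : R) : `|c - d| <= t ->
  t < `|c| -> (c < 0) = (d < 0).
Proof.
rewrite ler_norml => /andP[h1 h2].
by case: (ltrP c 0) => hc; case: (ltrP d 0) => hd //;
  rewrite ?(ger0_norm hc) ?(ltr0_norm hc); lra.
Qed.

(** The case analysis of [angle_lip] on bare reals: (a, b) and (c, d) are the two points, u and w
    their first coordinates divided by the sums of absolute values. *)
Lemma angle_cases (R : realType) (a b c d u w t : R) :
  (forall k, `|k * (1 - u) - k * (1 - w)| <= `|k| * (12 * t)) ->
  ((b < 0) != (d < 0) -> `|b| <= 2 * t /\ `|d| <= 2 * t) ->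
  ((b < 0) != (d < 0) -> (a < 0) = (c < 0)) -> 0 <= t ->
  (`|b| <= 2 * t -> (a < 0 -> `|1 + u| <= 4 * t) /\
                    (0 <= a -> `|1 - u| <= 4 * t)) ->
  (`|d| <= 2 * t -> (c < 0 -> `|1 + w| <= 4 * t) /\
                    (0 <= c -> `|1 - w| <= 4 * t)) ->
  let cut := [&& b < 0, 0 <= d & c < 0] || [&& d < 0, 0 <= b & a < 0] in
  let p := (if b < 0 then -1 else 1) * (1 - u) in
  let q := (if d < 0 then -1 else 1) * (1 - w) in
  [\/ cut = false /\ `|p - q| <= 12 * t,
      [/\ cut, p + 2 <= 12 * t & 2 - q <= 12 * t] |
      [/\ cut, 2 - p <= 12 * t & q + 2 <= 12 * t]].
Proof.
move=> same small sgn t0 sx sy.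
have [bl|bl] := ltrP b 0; have [dl|dl] := ltrP d 0; rewrite ?andbF ?orbF /=.
- by constructor 1; split=> //; have := same (-1); rewrite normrN normr1 mul1r.
- have bd : (b < 0) != (d < 0) by rewrite bl ltNge dl.
  have [/sx[sx0 sx1] /sy[sy0 sy1]] := small bd.
  have [c0|c0] := ltrP c 0.
    have /sx0 := etrans (sgn bd) c0; move: (sy0 c0); rewrite !ler_norml.
    by move=> /andP[? ?] /andP[? ?]; constructor 2; split=> //; lra.
  have a0 : 0 <= a by rewrite leNgt (sgn bd) -leNgt.
  move: (sx1 a0) (sy1 c0); rewrite !ler_norml => /andP[? ?] /andP[? ?].
  by constructor 1; split=> //; apply/andP; split; lra.
- have bd : (b < 0) != (d < 0) by rewrite dl ltNge bl.
  have [/sx[sx0 sx1] /sy[sy0 sy1]] := small bd.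
  have [a0|a0] := ltrP a 0.
    have /sy0 := etrans (esym (sgn bd)) a0; move: (sx0 a0); rewrite !ler_norml.
    by move=> /andP[? ?] /andP[? ?]; constructor 3; split=> //; lra.
  have c0 : 0 <= c by rewrite leNgt -(sgn bd) -leNgt.
  move: (sx1 a0) (sy1 c0); rewrite !ler_norml => /andP[? ?] /andP[? ?].
  by constructor 1; split=> //; apply/andP; split; lra.
- by constructor 1; split=> //; have := same 1; rewrite normr1 [X in _ <= X]mul1r.
Qed.

Section Plane.
Variable R : realType.
Let pt := (R^o * R^o)%type.
Variable n : pt -> R.
Hypothesis hn : is_norm n.

(** Moving x parallel to the side [q - p] reaches [(s + t) *: q] or [(s + t) *: p], whose norm is
    known; the triangle inequality does the rest. *)
Lemma hex_lower (p q : pt) (s t : R) : n p = 1 -> n q = 1 -> n (q - p) = 1 ->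
  0 <= s -> 0 <= t -> s <= n (s *: p + t *: q) /\ t <= n (s *: p + t *: q).
Proof.
move=> p1 q1 qp1 s0 t0; set x := s *: p + t *: q.
have xq : x + s *: (q - p) = (s + t) *: q.
  by rewrite /x; apply: injective_projections; rewrite /= /GRing.scale /=; ring.
have xp : x - t *: (q - p) = (s + t) *: p.
  by rewrite /x; apply: injective_projections; rewrite /= /GRing.scale /=; ring.
split.
- have := is_normB hn x (t *: (q - p)).
  by rewrite xp !(is_normZ_ge0 hn) ?addr_ge0// p1 qp1; lra.
- have := is_norm_triangle hn x (s *: (q - p)).
  by rewrite xq !(is_normZ_ge0 hn) ?addr_ge0// q1 qp1; lra.
Qed.

Lemma plane_dist (y x z : pt) : n (x - z) <= n (x - y) + n (y - z).
Proof. exact: is_norm_dist. Qed.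

Lemma plane_distC (x y : pt) : n (x - y) = n (y - x).
Proof. exact: is_normBC. Qed.

Lemma plane_lip (x y : pt) : `|n x - n y| <= n (x - y).
Proof. exact: is_norm_lip. Qed.

Hypothesis n10 : n (1, 0) = 1.
Hypothesis n01 : n (0, 1) = 1.
Hypothesis n11 : n (-1, 1) = 1.

Lemma plane_norm_le (x : pt) : n x <= `|x.1 : R| + `|x.2 : R|.
Proof.
have -> : x = x.1 *: ((1, 0) : pt) + x.2 *: ((0, 1) : pt).
  by apply: injective_projections; rewrite /= /GRing.scale /=; ring.
apply: le_trans (is_norm_triangle hn _ _) _.
by rewrite !(is_norm_homogeneous hn) n10 n01 /= /GRing.scale /=;
  rewrite !mulr1 !mulr0 addr0 add0r.
Qed.

(** Up to sign, x lies in one of three sectors of the inscribed hexagon. The factor 2 comes from the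
    sectors at the vertex (1, -1), where one coordinate of x is up to sign the sum of the two sector
    coordinates. *)
Lemma plane_norm_ge (x : pt) : `|x.1 : R| <= 2 * n x /\ `|x.2 : R| <= 2 * n x.
Proof.
wlog x10 : x / 0 <= x.1 => [th|].
  have [/th//|x0] := leP 0 x.1.
  have := th (- x); rewrite (is_normN hn) /= !normrN; apply.
  by rewrite oppr_ge0 ltW.
rewrite (ger0_norm x10).
have n11' : n (1, -1) = 1.
  rewrite -[RHS]n11 -[RHS](is_normN hn); congr n.
  by apply: injective_projections; rewrite /= ?opprK.
have nN01 : n (0, -1) = 1.
  rewrite -[RHS]n01 -[RHS](is_normN hn); congr n.
  by apply: injective_projections; rewrite /= ?oppr0.
have [x20|x20] := leP 0 x.2.
  rewrite ger0_norm//.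
  have e : n ((0, 1) - (1, 0)) = 1.
    rewrite -[RHS]n11; congr n.
    by apply: injective_projections; rewrite /= ?sub0r ?subr0.
  have [h1 h2] := hex_lower n10 n01 e x10 x20.
  suff E : x.1 *: ((1, 0) : pt) + x.2 *: ((0, 1) : pt) = x.
    by rewrite E in h1 h2; have := is_norm_ge0 hn x; split; lra.
  by apply: injective_projections; rewrite /= /GRing.scale /=; ring.
rewrite ltr0_norm//.
have [x12|x12] := leP (- x.2) x.1.
  have [|||h1 h2] := @hex_lower (1, 0) (1, -1) (x.1 + x.2) (- x.2) n10 n11'.
  - rewrite -[RHS]nN01; congr n.
    by apply: injective_projections; rewrite /= ?subrr ?subr0.
  - lra.
  - lra.
  suff E : (x.1 + x.2) *: ((1, 0) : pt) + (- x.2) *: ((1, -1) : pt) = x.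
    by rewrite E in h1 h2; split; lra.
  by apply: injective_projections; rewrite /= /GRing.scale /=; ring.
have [|||h1 h2] := @hex_lower (1, -1) (0, -1) x.1 (- x.2 - x.1) n11' nN01.
- rewrite -[RHS]n10 -[RHS](is_normN hn); congr n.
  by apply: injective_projections; rewrite /=; ring.
- lra.
- lra.
suff E : x.1 *: ((1, -1) : pt) + (- x.2 - x.1) *: ((0, -1) : pt) = x.
  by rewrite E in h1 h2; split; lra.
by apply: injective_projections; rewrite /= /GRing.scale /=; ring.
Qed.

(* The square |x1| + |x2| = 1, parametrized counterclockwise by [-2, 2] from
   (-1, 0) to (-1, 0). *)
Definition diamond (s : R) : pt := (1 - `|s|, `|s + 1| - `|s - 1| - s).

Definition circ (s : R) : pt := unit_of n (diamond s).

(** The inverse of [diamond] up to scaling ([diamond_angle]): an angle with values in [-2, 2], which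
    jumps from -2 to 2 across the negative horizontal axis. *)
Definition angle (x : pt) : R :=
  (if x.2 < 0 then -1 else 1) * (1 - x.1 / (`|x.1| + `|x.2|)).

(** The step crosses the negative horizontal axis, which counts as part of the upper half-plane.
    Only the upper end is tested for its first coordinate; for short steps away from 0 both ends
    have the same sign there. *)
Definition ray_cut (x y : pt) :=
  [&& x.2 < 0, 0 <= y.2 & y.1 < 0] || [&& y.2 < 0, 0 <= x.2 & x.1 < 0].

Lemma diamond_norm (s : R) : -2 <= s <= 2 -> 1 / 4 <= n (diamond s).
Proof.
move=> s2; have [] := plane_norm_ge (diamond s); rewrite /diamond /=.
move: (n _) => N.
case: (ger0P (s + 1)) => ?; case: (ger0P (s - 1)) => ?; case: (ger0P s) => ?;
  rewrite !ler_norml; lra.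
Qed.

Lemma circ_norm (s : R) : -2 <= s <= 2 -> n (circ s) = 1.
Proof. by move=> /diamond_norm s2; rewrite unit_of_norm//; lra. Qed.

Lemma circ_lip (s t : R) : -2 <= s <= 2 -> -2 <= t <= 2 ->
  n (circ s - circ t) <= 32 * `|s - t|.
Proof.
move=> /diamond_norm s2 /diamond_norm t2.
apply: le_trans (unit_of_lip hn _ _) _; [lra|lra|].
have d : n (diamond s - diamond t) <= 4 * `|s - t|.
  apply: le_trans (plane_norm_le _) _; rewrite /diamond /=.
  have h1 := ler_dist_dist s t; rewrite distrC in h1.
  have h2 := ler_dist_dist (s + 1) (t + 1).
  have h3 := ler_dist_dist (s - 1) (t - 1).
  have -> : 1 - `|s| - (1 - `|t|) = `|t| - `|s| by ring.
  have -> : `|s + 1| - `|s - 1| - s - (`|t + 1| - `|t - 1| - t) =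
    (`|s + 1| - `|t + 1|) - (`|s - 1| - `|t - 1|) - (s - t) by ring.
  have e1 : s + 1 - (t + 1) = s - t by ring.
  have e2 : s - 1 - (t - 1) = s - t by ring.
  rewrite e1 in h2; rewrite e2 in h3; rewrite distrC in h1.
  have := ler_normB (`|s + 1| - `|t + 1| - (`|s - 1| - `|t - 1|)) (s - t).
  have := ler_normB (`|s + 1| - `|t + 1|) (`|s - 1| - `|t - 1|).
  rewrite (distrC `|t|); lra.
(* The constant 32 is 8 from the normalization, since [diamond s] has norm at least 1 / 4, times the
   Lipschitz constant 4 of [diamond]. *)
have i4 : 2 / n (diamond s) <= 8.
  rewrite ler_pdivrMr; lra.
apply: le_trans (_ : 8 * (4 * `|s - t|) <= _); last by lra.
by apply: ler_pM => //; rewrite ?divr_ge0 ?(is_norm_ge0 hn).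
Qed.

Lemma l1_gt0 (x : pt) : 0 < n x -> 0 < `|x.1| + `|x.2|.
Proof. by move=> /lt_le_trans; apply; exact: plane_norm_le. Qed.

Lemma angle_range (x : pt) : 0 < n x -> -2 <= angle x <= 2.
Proof.
move=> /l1_gt0 r0; rewrite /angle; set r := _ + _ in r0 *.
have : `|x.1 / r| <= 1.
  by rewrite normrM normfV (gtr0_norm r0) ler_pdivrMr// mul1r lerDl.
by rewrite ler_norml; case: ifP => _; lra.
Qed.

Lemma diamond_angle (x : pt) : 0 < n x ->
  diamond (angle x) = (`|x.1| + `|x.2|)^-1 *: x.
Proof.
move=> /l1_gt0 r0; rewrite /angle; set r := _ + _ in r0 *.
set a := x.1 / r; set b := x.2 / r.
have ab : `|a| + `|b| = 1.
  by rewrite /a /b !normrM normfV (gtr0_norm r0) -mulrDl divff// gt_eqF.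
have bs : (x.2 < 0) = (b < 0) by rewrite /b ltr_pdivrMr// mul0r.
have -> : r^-1 *: x = (a, b).
  by apply: injective_projections; rewrite /= /GRing.scale /= mulrC.
have := ler_norm a; have a0 := normr_ge0 b; rewrite bs /diamond => a1.
have h1 : `|1 - a| = 1 - a by rewrite ger0_norm; lra.
have h2 : `|2 - a| = 2 - a by rewrite ger0_norm; lra.
case: (ltrP b 0) => b0; rewrite ?mulN1r ?mul1r.
  rewrite normrN h1 (_ : - (1 - a) + 1 = a); last by ring.
  rewrite (_ : - (1 - a) - 1 = - (2 - a)); last by ring.
  by rewrite normrN h2; rewrite (ltr0_norm b0) in ab; apply: injective_projections => /=; lra.
rewrite h1 (_ : 1 - a + 1 = 2 - a); last by ring.
rewrite (_ : 1 - a - 1 = - a); last by ring.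
by rewrite normrN h2; rewrite (ger0_norm b0) in ab; apply: injective_projections => /=; lra.
Qed.

Lemma circ_angle (x : pt) : 0 < n x -> circ (angle x) = unit_of n x.
Proof.
move=> x0; rewrite /circ diamond_angle// /unit_of.
have r0 := l1_gt0 x0.
rewrite (is_normZ_ge0 hn) ?invr_ge0 ?(ltW r0)// scalerA; congr (_ *: _).
by rewrite invfM invrK mulrAC mulfV ?mul1r// gt_eqF.
Qed.

Lemma angle_lip (x y : pt) (t : R) : 1 / 2 <= n x -> 1 / 2 <= n y ->
  n (x - y) <= t -> t <= 1 / 10 ->
  [\/ ray_cut x y = false /\ `|angle x - angle y| <= 12 * t,
      [/\ ray_cut x y, angle x + 2 <= 12 * t & 2 - angle y <= 12 * t] |
      [/\ ray_cut x y, 2 - angle x <= 12 * t & angle y + 2 <= 12 * t]].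
Proof.
move=> x2 y2 xyt t1.
have [/= d1 d2] := plane_norm_ge (x - y).
have rx := plane_norm_le x; have ry := plane_norm_le y.
have x0 : 0 < `|x.1| + `|x.2| by lra.
have y0 : 0 < `|y.1| + `|y.2| by lra.
have h1 := ler_dist_dist x.1 y.1; have h2 := ler_dist_dist x.2 y.2.
rewrite /ray_cut /angle; set r := `|x.1| + _ in x0 rx *; set r' := _ + `|y.2| in y0 ry *.
have rr' : `|r - r'| <= 4 * t.
  rewrite (_ : r - r' = (`|x.1| - `|y.1|) + (`|x.2| - `|y.2|)); last first.
    by rewrite /r /r'; ring.
  by apply: le_trans (ler_normD _ _) _; lra.
(* The numerator is at most 2 t + 4 t and r is at least 1 / 2, whence 12. *)
have lip : `|x.1 / r - y.1 / r'| <= 12 * t.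
  have -> : x.1 / r - y.1 / r' = ((x.1 - y.1) - (y.1 / r') * (r - r')) / r.
    by field; rewrite !gt_eqF.
  rewrite normrM normfV (gtr0_norm x0) ler_pdivrMr//.
  have : `|y.1 / r' * (r - r')| <= `|r - r'|.
    rewrite normrM ler_piMl// normrM normfV (gtr0_norm y0) ler_pdivrMr// mul1r.
    by rewrite lerDl.
  have := ler_normB (x.1 - y.1) (y.1 / r' * (r - r')).
  have : 12 * t * (1 / 2) <= 12 * t * r.
    by rewrite ler_wpM2l//; [have := is_norm_ge0 hn (x - y); lra|lra].
  lra.
have side (z : pt) (s : R) : 0 < s -> s = `|z.1| + `|z.2| -> 1 / 2 <= s ->
    `|z.2| <= 2 * t -> (z.1 < 0 -> `|1 + z.1 / s| <= 4 * t) /\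
                      (0 <= z.1 -> `|1 - z.1 / s| <= 4 * t).
  move=> s0 sE s2 z2; split=> z1.
    have -> : 1 + z.1 / s = `|z.2| / s.
      have -> : `|z.2| = s + z.1 by rewrite sE (ltr0_norm z1); ring.
      by rewrite mulrDl divff// gt_eqF.
    rewrite normrM normr_id normfV (gtr0_norm s0) ler_pdivrMr//.
    by apply: le_trans z2 _; have : 4 * t * (1 / 2) <= 4 * t * s;
      [rewrite ler_wpM2l//; have := is_norm_ge0 hn (x - y); lra|lra].
  have -> : 1 - z.1 / s = `|z.2| / s.
    have -> : `|z.2| = s - z.1 by rewrite sE (ger0_norm z1); ring.
    by rewrite mulrBl divff// gt_eqF.
  rewrite normrM normr_id normfV (gtr0_norm s0) ler_pdivrMr//.
  by apply: le_trans z2 _; have : 4 * t * (1 / 2) <= 4 * t * s;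
    [rewrite ler_wpM2l//; have := is_norm_ge0 hn (x - y); lra|lra].
have same c : `|c * (1 - x.1 / r) - c * (1 - y.1 / r')| <= `|c| * (12 * t).
  rewrite -mulrBr normrM ler_wpM2l//.
  by rewrite opprB addrC addrA subrK distrC.
have x2t : (x.2 < 0) != (y.2 < 0) -> `|x.2| <= 2 * t /\ `|y.2| <= 2 * t.
  by apply: opposite_signs_small; lra.
have sgn : (x.2 < 0) != (y.2 < 0) -> (x.1 < 0) = (y.1 < 0).
  move=> /x2t[a b]; apply: (@far_same_sign _ _ _ (2 * t)); [|move: rx; rewrite /r]; lra.
have t0 : 0 <= t by have := is_norm_ge0 hn (x - y); lra.
have := side y r' y0 erefl (le_trans y2 ry).
have := side x r x0 erefl (le_trans x2 rx).
move: same x2t sgn t0; clear; exact: angle_cases.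
Qed.

End Plane.

(** * Cocycles on an annulus *)

Lemma addb_triangles (a b c d e : bool) : a (+) b = c -> d (+) e = c ->
  a (+) d (+) e = b.
Proof. by case: a; case: b; case: c; case: d; case: e. Qed.

Lemma addb_glue (x y p m ac bc ab : bool) : x (+) m = ac -> y (+) p = bc ->
  ac (+) bc = ab -> ab = x (+) y (+) (p (+) m).
Proof. by case: x; case: y; case: p; case: m => <- <- <-. Qed.

Section Potential.
Variable R : realType.
Let pt := (R^o * R^o)%type.
Variable n : pt -> R.
Hypothesis hn : is_norm n.
Hypothesis n10 : n (1, 0) = 1.
Hypothesis n01 : n (0, 1) = 1.
Hypothesis n11 : n (-1, 1) = 1.
Local Notation circle := (circ n).

Variables (eps : R) (g : pt -> pt -> bool).
Hypothesis eps0 : 0 < eps.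
Hypothesis eps1 : eps <= 1 / 2.
Hypothesis gC : forall x y, g x y = g y x.
Hypothesis gD : forall x y z, `|n x - 1| <= eps -> `|n y - 1| <= eps ->
  `|n z - 1| <= eps -> n (x - y) <= eps -> n (y - z) <= eps ->
  n (x - z) <= eps -> g x y (+) g y z = g x z.

Lemma cocycle_near x y z r s : `|n x - 1| <= eps -> `|n y - 1| <= eps ->
  `|n z - 1| <= eps -> n (x - y) <= r -> n (y - z) <= s -> r + s <= eps ->
  g x y (+) g y z = g x z.
Proof.
move=> x1 y1 z1 xy yz rs; apply: gD => //.
- by apply: le_trans xy _; have := is_norm_ge0 hn (y - z); lra.
- by apply: le_trans yz _; have := is_norm_ge0 hn (x - y); lra.
- by apply: le_trans (plane_dist hn y x z) _; lra.
Qed.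

(** With this many pieces a step of [arc_sum] has length at most 32 * 2 / K <= eps / 5, short enough
    for two consecutive sides of a small square in [cocycle_near]. *)
Let K := (Num.bound (320 / eps)).+1.

(** The integral of [g] along the arc from [circle 0] to [circle s]. The number of pieces does not
    depend on s, so that two arcs can be compared piece by piece. *)
Definition arc_sum (s : R) :=
  \big[addb/false]_(k < K) g (circle (k%:R / K%:R * s)) (circle (k.+1%:R / K%:R * s)).

Lemma unit_annulus (x : pt) : n x = 1 -> `|n x - 1| <= eps.
Proof. by move=> ->; rewrite subrr normr0 ltW. Qed.

Lemma cocycle_refl (x : pt) : n x = 1 -> g x x = false.
Proof.
move=> /unit_annulus x1; have e : n (x - x) <= eps.
  by rewrite subrr (is_norm0 hn) ltW.
by have := gD x1 x1 x1 e e e; case: (g x x).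
Qed.

(** The two arcs form a ladder with rungs of length at most eps / 5, and [g] sums to zero around
    each of its small squares. The sums telescope to the last rung, the first one being trivial. *)
Lemma arc_sumB (s t : R) : -2 <= s <= 2 -> -2 <= t <= 2 ->
  `|s - t| <= eps / 160 -> arc_sum s (+) arc_sum t = g (circle s) (circle t).
Proof.
have ep0 := eps0; move=> s2 t2 st.
have e25 : eps / 5 + eps / 5 <= eps by lra.
have K0 : (0 : R) < K%:R by rewrite ltr0n.
have rng (u : R) j : -2 <= u <= 2 -> (j <= K)%N -> -2 <= (j%:R / K%:R * u : R) <= 2.
  move=> u2 jK; have j1 : 0 <= (j%:R / K%:R : R) <= 1.
    by rewrite divr_ge0//= ler_pdivrMr// mul1r ler_nat.
  have : `|j%:R / K%:R * u| <= 2.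
    rewrite normrM ger0_norm; last by case/andP: j1.
    have : `|u| <= 2 by rewrite ler_norml.
    by move=> /(ler_pM _ _ (proj2 (andP j1))); rewrite mul1r; apply => //;
       case/andP: j1.
  by rewrite ler_norml.
have ann (u : R) j : -2 <= u <= 2 -> (j <= K)%N ->
    `|n (circle (j%:R / K%:R * u)) - 1| <= eps.
  by move=> u2 jK; apply: unit_annulus; apply: circ_norm => //; exact: rng.
have rung j : (j <= K)%N ->
    n (circle (j%:R / K%:R * s) - circle (j%:R / K%:R * t)) <= eps / 5.
  move=> jK; apply: le_trans (circ_lip hn n10 n01 n11 (rng s j s2 jK) (rng t j t2 jK)) _.
  have : `|j%:R / K%:R * s - j%:R / K%:R * t| <= `|s - t|.
    rewrite -mulrBr normrM ler_piMl// ger0_norm ?divr_ge0//.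
    by rewrite ler_pdivrMr// mul1r ler_nat.
  lra.
have step (u : R) j : -2 <= u <= 2 -> (j < K)%N ->
    n (circle (j%:R / K%:R * u) - circle (j.+1%:R / K%:R * u)) <= eps / 5.
  move=> u2 jK.
  apply: le_trans (circ_lip hn n10 n01 n11 (rng u j u2 (ltnW jK)) (rng u _ u2 jK)) _.
  have -> : j%:R / K%:R * u - j.+1%:R / K%:R * u = - (u / K%:R).
    by rewrite -natr1; field; rewrite gt_eqF.
  have : 320 / eps <= K%:R :> R.
    apply: ltW; apply: lt_le_trans (archi_boundP _) _; last by rewrite ler_nat.
    exact: divr_ge0 (ler0n _ _) (ltW ep0).
  rewrite ler_pdivrMr// mulrC => h.
  have u2' : `|u| <= 2 by rewrite ler_norml.
  rewrite normrN normrM normfV (gtr0_norm K0) mulrA ler_pdivrMr//.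
  lra.
have H j : (j <= K)%N ->
   (\big[addb/false]_(k < j) g (circle (k%:R / K%:R * s)) (circle (k.+1%:R / K%:R * s)))
   (+) (\big[addb/false]_(k < j) g (circle (k%:R / K%:R * t)) (circle (k.+1%:R / K%:R * t)))
   = g (circle (j%:R / K%:R * s)) (circle (j%:R / K%:R * t)).
  elim: j => [_|j IH jK].
    rewrite !big_ord0 !mul0r cocycle_refl//.
    by apply: circ_norm => //; lra.
  have jK' := ltnW jK; rewrite !big_ord_recr /= addbACA IH//.
  move: (ann s j s2 jK') (ann s j.+1 s2 jK) (ann t j t2 jK') (ann t j.+1 t2 jK).
  move: (rung j jK') (rung j.+1 jK) (step s j s2 jK) (step t j t2 jK).
  move: (circle (j%:R / K%:R * s)) (circle (j%:R / K%:R * t)) => a b.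
  move: (circle (j.+1%:R / K%:R * s)) (circle (j.+1%:R / K%:R * t)) => c d.
  move=> ab cd ac bd na nc nb nd.
  have e1 := cocycle_near na nc nd ac cd e25.
  have e2 := cocycle_near na nb nd ab bd e25.
  move: e1 e2; move: (g a b) (g a c) (g c d) (g b d) (g a d).
  by do 5!case.
by rewrite /arc_sum H// !divff ?gt_eqF// !mul1r.
Qed.

Lemma circ2 : circle 2 = circle (-2).
Proof.
rewrite /circ /diamond; congr unit_of.
apply: injective_projections => /=; rewrite ?normrN//.
rewrite (_ : `|2 + 1| = 3 :> R); last by rewrite ger0_norm; lra.
rewrite (_ : `|2 - 1| = 1 :> R); last by rewrite ger0_norm; lra.
rewrite (_ : `|- 2 + 1| = 1 :> R); last by rewrite ler0_norm; lra.
by rewrite (_ : `|- 2 - 1| = 3 :> R); [ring|rewrite ler0_norm; lra].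
Qed.

(** The parameters are near the two ends -2 and 2, which give the same point of the circle; the
    error is the total of [g] around the circle. *)
Lemma arc_sum_cut (s t : R) : -2 <= s <= 2 -> -2 <= t <= 2 ->
  s + 2 <= eps / 160 -> 2 - t <= eps / 160 ->
  g (circle s) (circle t) = arc_sum s (+) arc_sum t (+) (arc_sum 2 (+) arc_sum (-2)).
Proof.
have ep0 := eps0.
have b2 : -2 <= (2 : R) <= 2 by apply/andP; split; lra.
have b2' : -2 <= (-2 : R) <= 2 by apply/andP; split; lra.
have e5 : 32 * (eps / 160) + 32 * (eps / 160) <= eps by lra.
move=> s2 t2; have /andP[s2a s2b] := s2; have /andP[t2a t2b] := t2 => hs ht.
have h1 : `|s - -2| <= eps / 160 by rewrite ger0_norm; lra.
have h2 : `|t - 2| <= eps / 160 by rewrite ler0_norm; lra.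
have e1 := arc_sumB s2 b2' h1.
have e2 := arc_sumB t2 b2 h2; rewrite circ2 in e2.
apply: addb_glue e1 e2 _; rewrite (gC (circle t)).
have d1 := le_trans (circ_lip hn n10 n01 n11 s2 b2') (ler_wpM2l (ler0n _ _) h1).
have d2 := le_trans (circ_lip hn n10 n01 n11 t2 b2) (ler_wpM2l (ler0n _ _) h2).
rewrite circ2 (plane_distC hn) in d2.
by apply: (cocycle_near _ _ _ d1 d2 e5); apply: unit_annulus; apply: circ_norm.
Qed.

(* A mod 2 cocycle of small steps in an annulus is a coboundary up to a
   multiple [tau] of the class that counts the crossings of a ray. *)
Lemma annulus_potential : exists (H : pt -> bool) (tau : bool), forall x y,
  `|n x - 1| <= eps / 4 -> `|n y - 1| <= eps / 4 -> n (x - y) <= eps / 2000 ->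
  g x y = H x (+) H y (+) (tau && ray_cut x y).
Proof.
(* The potential integrates [g] along the circle to the projection of x and then radially to x;
   [tau] is the total around the circle. The step eps / 2000 ensures 12 * (eps / 2000) <= eps / 160,
   which links [angle_lip] to [arc_sumB]. *)
exists (fun x => arc_sum (angle x) (+) g (unit_of n x) x).
exists (arc_sum 2 (+) arc_sum (-2)) => x y nx ny xy.
have ep0 := eps0; have ep1 := eps1.
have nx0 : 1 / 2 <= n x by move: nx; rewrite ler_norml => /andP[? ?]; lra.
have ny0 : 1 / 2 <= n y by move: ny; rewrite ler_norml => /andP[? ?]; lra.
have x0 : 0 < n x by lra.
have y0 : 0 < n y by lra.
have xX := dist_unit_of hn x0; rewrite distrC in xX.
have yY := dist_unit_of hn y0; rewrite distrC in yY.
have X1 := unit_of_norm hn x0; have Y1 := unit_of_norm hn y0.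
have e1 : eps / 4 + eps / 2000 <= eps by lra.
have e2 : eps / 4 + eps / 2000 + eps / 4 + eps / 4 <= eps by lra.
have e4 : eps / 4 <= eps by lra.
have gxy : g x y = g (unit_of n x) x (+) g (unit_of n x) (unit_of n y)
                   (+) g (unit_of n y) y.
  move: (unit_of n x) (unit_of n y) X1 Y1 xX yY => X Y /unit_annulus X1.
  move=> /unit_annulus Y1 Xx Yy.
  have nx' := le_trans nx e4; have ny' := le_trans ny e4.
  rewrite distrC in nx; rewrite distrC in ny.
  have Xx' : n (X - x) <= eps / 4 by rewrite Xx distrC.
  have Yy' : n (Y - y) <= eps / 4 by rewrite Yy distrC.
  have Xy := le_trans (plane_dist hn x X y) (lerD Xx' xy).
  have XY := le_trans (plane_dist hn y X Y) (lerD Xy (lexx (n (y - Y)))).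
  rewrite (plane_distC hn y Y) in XY.
  have XY' := le_trans XY (lerD (lexx _) Yy').
  apply/esym; apply: addb_triangles (cocycle_near X1 nx' ny' Xx' xy e1) _.
  by apply: cocycle_near X1 Y1 ny' XY' Yy' e2.
have ax := angle_range hn n10 n01 x0; have ay := angle_range hn n10 n01 y0.
rewrite gxy; suff -> : g (unit_of n x) (unit_of n y) = arc_sum (angle x) (+) arc_sum (angle y)
    (+) ((arc_sum 2 (+) arc_sum (-2)) && ray_cut x y).
  move: (_ && _) (g _ x) (g _ y) (arc_sum _) (arc_sum _).
  by case; case; case; case; case.
rewrite -!(circ_angle hn n10 n01)//.
have e6 : 12 * (eps / 2000) <= eps / 160 by lra.
have e7 : eps / 2000 <= 1 / 10 by lra.
have [[-> axy]|[-> a2 b1]|[-> a2 b1]] := angle_lip hn n10 n01 n11 nx0 ny0 xy e7.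
- by rewrite andbF addbF (arc_sumB ax ay (le_trans axy e6)).
- by rewrite andbT (arc_sum_cut ax ay (le_trans a2 e6) (le_trans b1 e6)).
- by rewrite andbT gC (arc_sum_cut ay ax (le_trans b1 e6) (le_trans a2 e6))
    (addbC (arc_sum (angle y))).
Qed.

End Potential.

(** * Colorings along inscribed hexagons *)

(** The positive steps for a cyclic order of three colors; their number mod 2 replaces a winding
    number. *)
Definition cyc3 (c c' : option bool) : bool :=
  match c, c' with
  | None, Some true | Some true, Some false | Some false, None => true
  | _, _ => false
  end.

(** Of the two colors other than p, one follows p and the other precedes it. *)
Lemma cyc3_flip (c c' p : option bool) : c != p -> c' != p ->
  cyc3 c p (+) cyc3 c' p = (c != c') /\ cyc3 p c (+) cyc3 p c' = (c != c').
Proof. by case: c => [[]|]; case: c' => [[]|]; case: p => [[]|]. Qed.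

Lemma third_color_unique (c c' p q : option bool) : p != q -> c != p -> c != q ->
  c' != p -> c' != q -> c' = c.
Proof.
by case: c => [[]|]; case: c' => [[]|]; case: p => [[]|]; case: q => [[]|].
Qed.

(* The steps of a closed walk of length 6 on a triangle go round it, or three
   of them are positive. *)
Lemma six_walk (c0 c1 c2 c3 c4 c5 : option bool) :
  c0 != c1 -> c1 != c2 -> c2 != c3 -> c3 != c4 -> c4 != c5 -> c5 != c0 ->
  cyc3 c0 c1 (+) cyc3 c1 c2 (+) cyc3 c2 c3 (+) cyc3 c3 c4 (+) cyc3 c4 c5
    (+) cyc3 c5 c0 = false ->
  [&& c0 != c2, c1 != c3, c2 != c4, c3 != c5, c4 != c0 & c5 != c1].
Proof.
case: c0 => [[]|]; case: c1 => [[]|] // _; case: c2 => [[]|] // _;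
case: c3 => [[]|] // _; case: c4 => [[]|] // _; by case: c5 => [[]|].
Qed.

Section Hexagon.
Variable R : realType.
Let pt := (R^o * R^o)%type.
Variable n : pt -> R.
Hypothesis hn : is_norm n.
Hypothesis n10 : n (1, 0) = 1.
Hypothesis n01 : n (0, 1) = 1.
Hypothesis n11 : n (-1, 1) = 1.

(** X and Y run over the consecutive arcs from (1, 0) to (0, 1) and from (0, 1) to (-1, 1). A
    hexagon is given by s and t with [Y t - X s] of norm 1, and s going from 0 to 1 turns it by one
    step. *)
Let X (s : R) : pt := unit_of n (1 - s, s).
Let Y (t : R) : pt := unit_of n (- t, 1).

Lemma hexagon_gt0 (s t : R) : 0 <= s <= 1 -> 0 <= t <= 1 ->
  1 / 4 <= n (1 - s, s) /\ 1 / 4 <= n (- t, 1).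
Proof.
move=> /andP[s0 s1] /andP[t0 t1].
have [/= a b] := plane_norm_ge hn n10 n01 n11 (1 - s, s).
have [/= _ d] := plane_norm_ge hn n10 n01 n11 (- t, 1).
rewrite (ger0_norm s0) in b; rewrite ger0_norm ?subr_ge0// in a.
by rewrite normr1 in d; split; lra.
Qed.

Lemma hexagon_unit (s t : R) : 0 <= s <= 1 -> 0 <= t <= 1 ->
  n (X s) = 1 /\ n (Y t) = 1.
Proof.
by move=> s1 t1; have [a b] := hexagon_gt0 s1 t1;
  split; rewrite unit_of_norm//; lra.
Qed.

Lemma unit_of_quarter_lip (x y : pt) : 1 / 4 <= n x -> 1 / 4 <= n y ->
  n (unit_of n x - unit_of n y) <= 8 * n (x - y).
Proof.
move=> x4 y4; apply: le_trans (unit_of_lip hn _ _) _; [lra|lra|].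
by apply: ler_wpM2r; [exact: is_norm_ge0|rewrite ler_pdivrMr; lra].
Qed.

Lemma hexagonX_lip (s t : R) : 0 <= s <= 1 -> 0 <= t <= 1 ->
  n (X s - X t) <= 16 * `|s - t|.
Proof.
move=> s1 t1; have [a _] := hexagon_gt0 s1 s1; have [b _] := hexagon_gt0 t1 t1.
have h : n ((1 - s, s) - (1 - t, t) : pt) <= 2 * `|s - t|.
  apply: le_trans (plane_norm_le hn n10 n01 _) _ => /=.
  by rewrite (_ : 1 - s - (1 - t) = - (s - t)) ?normrN; [lra|ring].
apply: le_trans (unit_of_quarter_lip a b) _.
by apply: le_trans (ler_wpM2l _ h) _ => //; lra.
Qed.

Lemma hexagonY_lip (s t : R) : 0 <= s <= 1 -> 0 <= t <= 1 ->
  n (Y s - Y t) <= 16 * `|s - t|.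
Proof.
move=> s1 t1; have [_ a] := hexagon_gt0 s1 s1; have [_ b] := hexagon_gt0 t1 t1.
have h : n ((- s, 1) - (- t, 1) : pt) <= `|s - t|.
  apply: le_trans (plane_norm_le hn n10 n01 _) _ => /=.
  by rewrite subrr normr0 addr0 -opprD normrN.
apply: le_trans (unit_of_quarter_lip a b) _.
by apply: le_trans (ler_wpM2l _ h) _ => //; have := normr_ge0 (s - t); lra.
Qed.

Lemma hexagon_mono (s t t' : R) : 0 <= s <= 1 -> 0 <= t -> t <= t' -> t' <= 1 ->
  n (Y t - X s) <= n (Y t' - X s).
Proof.
move=> s01 t0 tt' t1; have /andP[s0 s1] := s01.
have t01 : 0 <= t <= 1 by lra.
have t01' : 0 <= t' <= 1 by lra.
have [Dz|D0] := eqVneq (1 - s + s * t') 0.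
  have st0 : 0 <= s * t' by rewrite mulr_ge0//; lra.
  have s1' : s = 1 by lra.
  have t'0 : t' = 0 by move: Dz; rewrite s1' => ?; lra.
  by rewrite (_ : t = t')//; lra.
have [x4 y4] := hexagon_gt0 s01 t01; have [_ y4'] := hexagon_gt0 s01 t01'.
have [x1 y1] := hexagon_unit s01 t01; have [_ y1'] := hexagon_unit s01 t01'.
set D := 1 - s + s * t' in D0.
have D1 : 0 < D.
  by rewrite lt_neqAle eq_sym D0/= addr_ge0 ?mulr_ge0 ?subr_ge0//; lra.
(* Cramer's rule for (-t, 1) in terms of (1 - s, s) and (-t', 1), whose determinant is [D], rescaled
   by the norms. *)
set a := (t' - t) / D * (n (1 - s, s) / n (- t, 1)).
set b := (1 - s + s * t) / D * (n (- t', 1) / n (- t, 1)).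
apply: (@quadrilateral _ _ _ hn (X s) (Y t) (Y t') a b) => //.
- by apply: mulr_ge0; apply: divr_ge0;
    [rewrite subr_ge0|exact: ltW|exact: is_norm_ge0|exact: is_norm_ge0].
- apply: mulr_ge0; apply: divr_ge0;
    [|exact: ltW|exact: is_norm_ge0|exact: is_norm_ge0].
  by rewrite addr_ge0 ?subr_ge0// mulr_ge0.
rewrite /X /Y /unit_of !scalerA /a /b.
move: x4 y4 y4'; move: (n _) (n _) (n _) => p q r p4 q4 r4.
have p0 : r != 0 by rewrite gt_eqF//; lra.
have q0 : q != 0 by rewrite gt_eqF//; lra.
have r0 : p != 0 by rewrite gt_eqF//; lra.
by apply: injective_projections; rewrite /= /GRing.scale /= /D; field;
  rewrite p0 q0 r0 D0.
Qed.

Lemma hexagon_ends (s : R) : 0 <= s <= 1 -> n (Y 0 - X s) <= 1 <= n (Y 1 - X s).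
Proof.
move=> s01; have /andP[s0 s1] := s01.
have z01 : 0 <= (0 : R) <= 1 by rewrite lexx ler01.
have [x4 _] := hexagon_gt0 s01 z01; have [x1 _] := hexagon_unit s01 z01.
have Y0 : Y 0 = (0, 1) by rewrite /Y oppr0 unit_of_id.
have Y1 : Y 1 = (-1, 1) by rewrite /Y unit_of_id.
rewrite Y0 Y1; apply/andP; split.
  rewrite (plane_distC hn) -[leRHS]n11 -(is_normN hn (-1, 1)).
  rewrite (_ : - ((-1, 1) : pt) = (1, 0) - (0, 1)); last first.
    by apply: injective_projections; rewrite /= ?opprK ?subr0 ?sub0r.
  apply: (@quadrilateral _ _ _ hn _ _ _ (s / n (1 - s, s)) ((1 - s) / n (1 - s, s))) => //.
  - by rewrite divr_ge0//; lra.
  - by rewrite divr_ge0//; lra.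
  rewrite /X /unit_of; apply: injective_projections; rewrite /= /GRing.scale /=; ring.
rewrite (plane_distC hn) -[leLHS]n10.
rewrite (_ : ((1, 0) : pt) = (0, 1) - (-1, 1)); last first.
  by apply: injective_projections; rewrite /=; ring.
apply: (@quadrilateral _ _ _ hn _ _ _ (1 - s) (n (1 - s, s))) => //; [lra|lra|].
have nz : n (1 - s, s) != 0 by rewrite gt_eqF//; lra.
by rewrite /X /unit_of scalerA divff// scale1r; apply: injective_projections;
  rewrite /= /GRing.scale /=; ring.
Qed.

Definition near_hexagon (r : R) (u : pt * pt) :=
  [/\ `|n u.1 - 1| <= r, `|n u.2 - 1| <= r & `|n (u.2 - u.1) - 1| <= r].

Definition hexagon_close (r : R) (u v : pt * pt) :=
  [/\ n (u.1 - v.1) <= r, n (u.2 - v.2) <= r &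
      n ((u.2 - u.1) - (v.2 - v.1)) <= r].

(* Affine regular hexagons inscribed in the unit circle are parametrized by two
   consecutive vertices u.1, u.2; turning the hexagon by one step is a path in
   the space of hexagons. *)
Lemma hexagon_path (r : R) (I : pt * pt -> Prop) : 0 < r ->
  (forall u v, near_hexagon r u -> near_hexagon r v -> hexagon_close r u v ->
    I u -> I v) ->
  I ((1, 0), (0, 1)) -> I ((0, 1), (-1, 1)).
Proof.
move=> r0 Istep I0.
have r2 : 0 < r / 32 by lra.
have good s t : 0 <= s <= 1 -> 0 <= t <= 1 -> `|n (Y t - X s) - 1| <= r ->
    near_hexagon r (X s, Y t).
  move=> s01 t01 h; have [x1 y1] := hexagon_unit s01 t01.
  by split=> //=; rewrite ?x1 ?y1 subrr normr0 ltW.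
(* For fixed s the distance is monotone in t, so all values between two admissible ones are
   admissible. *)
have slide s t t' : 0 <= s <= 1 -> 0 <= t <= 1 -> 0 <= t' <= 1 ->
    `|n (Y t - X s) - 1| <= r -> `|n (Y t' - X s) - 1| <= r ->
    I (X s, Y t) -> I (X s, Y t').
  move=> s01 t01 t01' h h' Ist.
  pose m z := t + z * (t' - t).
  have mE z : m z = (1 - z) * t + z * t' by rewrite /m; ring.
  have m01 z : 0 <= z <= 1 -> 0 <= m z <= 1.
    move=> /andP[z0 z1]; case/andP: t01 => ta tb; case/andP: t01' => ta' tb'.
    rewrite mE addr_ge0 ?mulr_ge0 ?subr_ge0//=.
    have : (1 - z) * t <= (1 - z) * 1 by rewrite ler_wpM2l ?subr_ge0.
    have : z * t' <= z * 1 by rewrite ler_wpM2l.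
    lra.
  have mgood z : 0 <= z <= 1 -> near_hexagon r (X s, Y (m z)).
    move=> z01; have mz := m01 z z01; apply: good => //.
    case/andP: (mz) => mz0 mz1; case/andP: t01 => ta tb; case/andP: t01' => ta' tb'.
    case/andP: z01 => z0 z1.
    move: h h'; rewrite !ler_norml => /andP[h1 h2] /andP[h3 h4].
    have [tt'|tt'] := leP t t'.
      have a1 : t <= m z by rewrite /m lerDl mulr_ge0// subr_ge0.
      have a2 : m z <= t'.
        by rewrite mE; have : (1 - z) * t <= (1 - z) * t';
          [rewrite ler_wpM2l// subr_ge0|lra].
      have b1 := hexagon_mono s01 ta a1 mz1.
      have b2 := hexagon_mono s01 mz0 a2 tb'.
      by apply/andP; split; [apply: le_trans h1 _|apply: le_trans h4]; rewrite lerD2r.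
    have a1 : m z <= t.
      by rewrite /m gerDl mulr_ge0_le0// subr_le0 ltW.
    have a2 : t' <= m z.
      by rewrite mE; have : (1 - z) * t' <= (1 - z) * t;
        [rewrite ler_wpM2l ?subr_ge0// ltW|lra].
    have b1 := hexagon_mono s01 ta' a2 mz1.
    have b2 := hexagon_mono s01 mz0 a1 tb.
    by apply/andP; split; [apply: le_trans h3 _|apply: le_trans h2]; rewrite lerD2r.
  have -> : t' = m 1 by rewrite /m mul1r addrC subrK.
  apply: (@unit_interval_transport R (fun z => I (X s, Y (m z))) _ r2); last first.
    by rewrite /m mul0r addr0.
  move=> z z' z01 z01' zz'; apply: Istep (mgood z z01) (mgood z' z01') _.
  have YY : n (Y (m z) - Y (m z')) <= r.
    apply: le_trans (hexagonY_lip (m01 z z01) (m01 z' z01')) _.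
    have -> : m z - m z' = (z - z') * (t' - t) by rewrite /m; ring.
    have : `|(z - z') * (t' - t)| <= `|z - z'| * 1.
      rewrite normrM ler_wpM2l// ler_norml.
      by case/andP: t01 => ta tb; case/andP: t01' => ta' tb'; apply/andP; split; lra.
    lra.
  split=> //=; first by rewrite subrr (is_norm0 hn) ltW.
  by rewrite opprB addrA subrK.
have root s : 0 <= s <= 1 -> exists2 t, 0 <= t <= 1 & n (Y t - X s) = 1.
  move=> s01; apply: (@lipschitz_IVT R (fun t => n (Y t - X s)) 16).
    move=> t t' t01 t01'; apply: le_trans (plane_lip hn _ _) _.
    by rewrite opprB addrA subrK; apply: hexagonY_lip.
  exact: hexagon_ends.
(* When the circle contains segments, t is not determined by s; quantifying over all approximate
   solutions avoids a continuous choice. *)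
pose P s := forall t, 0 <= t <= 1 -> `|n (Y t - X s) - 1| <= r -> I (X s, Y t).
have X0 : X 0 = (1, 0) by rewrite /X subr0 unit_of_id.
have X1 : X 1 = (0, 1) by rewrite /X subrr unit_of_id.
have Y0 : Y 0 = (0, 1) by rewrite /Y oppr0 unit_of_id.
have Y1 : Y 1 = (-1, 1) by rewrite /Y unit_of_id.
have z01 : 0 <= (0 : R) <= 1 by rewrite lexx ler01.
have o01 : 0 <= (1 : R) <= 1 by rewrite lexx ler01.
have P0 : P 0.
  move=> t t01 ht; apply: (slide 0 0 t) => //; last by rewrite X0 Y0.
  rewrite X0 Y0 (_ : ((0, 1) - (1, 0) : pt) = (-1, 1)).
    by rewrite n11 subrr normr0 ltW.
  by apply: injective_projections; rewrite /= ?sub0r ?subr0.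
suff : P 1.
  move=> /(_ 1 o01); rewrite X1 Y1; apply.
  rewrite (_ : ((-1, 1) - (0, 1) : pt) = - (1, 0)).
    by rewrite (is_normN hn) n10 subrr normr0 ltW.
  by apply: injective_projections; rewrite /= ?subrr ?subr0 ?oppr0.
apply: (@unit_interval_transport R P _ r2) => // s s' s01 s01' ss' Ps t' t01' ht'.
have [t t01 ht] := root s s01.
have XX : n (X s - X s') <= r.
  by apply: le_trans (hexagonX_lip s01 s01') _; lra.
have g1 : `|n (Y t - X s') - 1| <= r.
  rewrite -ht; apply: le_trans (plane_lip hn _ _) _.
  by rewrite opprB addrC addrA subrK.
have h1 : `|n (Y t - X s) - 1| <= r by rewrite ht subrr normr0 ltW.
apply: (slide s' t t') => //.
apply: (Istep (X s, Y t)); [exact: good|exact: good| |exact: Ps].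
split=> //=; first by rewrite subrr (is_norm0 hn) ltW.
by rewrite opprB addrC addrA subrK (plane_distC hn).
Qed.

Definition turn (u : pt * pt) : pt * pt := (u.2, u.2 - u.1).

Lemma near_hexagon_turn (r : R) u : near_hexagon r u -> near_hexagon r (turn u).
Proof.
case=> h1 h2 h3; split=> //=.
by rewrite [_ - _ - _]addrAC subrr sub0r (is_normN hn).
Qed.

Lemma hexagon_close_turn (r : R) u v :
  hexagon_close r u v -> hexagon_close r (turn u) (turn v).
Proof.
case=> h1 h2 h3; split=> //=.
by rewrite ![_ - _ - _.2]addrAC !subrr !sub0r -opprD (is_normN hn).
Qed.

Lemma turn6 u : iter 6 turn u = u.
Proof.
by case: u => [[a b] [c d]]; rewrite /turn /=; congr (_, _);
  apply: injective_projections => /=; ring.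
Qed.

Section ThreeColors.
Variables (r : R) (k : pt -> option bool) (H : pt -> bool).
Hypothesis r0 : 0 < r.
Hypothesis kfar : forall x y, `|n x - 1| <= r -> `|n y - 1| <= r ->
  `|n (x - y) - 1| <= 3 * r -> k x != k y.
Hypothesis kH : forall x y, `|n x - 1| <= r -> `|n y - 1| <= r ->
  n (x - y) <= r -> (k x != k y) = H x (+) H y.

(** The direction of the color step along a side, corrected by the potential. A change of color at
    one end flips two terms, so this phase is constant along paths of hexagons. *)
Let q (u : pt * pt) := cyc3 (k u.1) (k u.2) (+) H u.1 (+) H u.2.

Lemma unit_dist_perturb (x y z : pt) : `|n (x - y) - 1| <= r -> n (x - z) <= r ->
  `|n (z - y) - 1| <= 3 * r.
Proof.
move=> xy xz; have r1 := r0; have := plane_lip hn (z - y) (x - y).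
rewrite (_ : z - y - (x - y) = z - x); last by rewrite opprB addrA subrK.
rewrite (plane_distC hn z x) => h.
have := ler_normD (n (z - y) - n (x - y)) (n (x - y) - 1).
rewrite (_ : _ + (n (x - y) - 1) = n (z - y) - 1); last by ring.
by lra.
Qed.

Lemma near_hexagon_colors u : near_hexagon r u -> k u.1 != k u.2.
Proof.
case=> u1 u2 u3; apply: kfar => //; rewrite (plane_distC hn).
by apply: le_trans u3 _; have := r0; lra.
Qed.

Lemma hexagon_phase_close u v : near_hexagon r u -> near_hexagon r v ->
  hexagon_close r u v -> q u = q v.
Proof.
move=> hu hv [uv1 uv2 _]; have [u1 u2 u3] := hu; have [v1 v2 v3] := hv.
have ku := near_hexagon_colors hu; have kv := near_hexagon_colors hv.
(* The mixed pair (v.1, u.2) still has distinct colors, so the two vertices can be changed one at a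
   time. *)
have kvu : k v.1 != k u.2.
  by apply: kfar => //; apply: unit_dist_perturb uv1; rewrite (plane_distC hn).
have [e1 _] := cyc3_flip ku kvu.
have [_ e2] : cyc3 (k u.2) (k v.1) (+) cyc3 (k v.2) (k v.1) = (k u.2 != k v.2) /\
    cyc3 (k v.1) (k u.2) (+) cyc3 (k v.1) (k v.2) = (k u.2 != k v.2).
  by apply: cyc3_flip; rewrite eq_sym.
move: e1 e2; rewrite (kH u1 v1 uv1) (kH u2 v2 uv2) /q.
move: (cyc3 _ _) (cyc3 _ _) (cyc3 _ _) (H _) (H _) (H _) (H _).
by do 7!case.
Qed.

Let hex := (((1, 0), (0, 1)) : pt * pt).

Lemma iter_turn (P : pt * pt -> Prop) j u :
  (forall u, P u -> P (turn u)) -> P u -> P (iter j turn u).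
Proof. by move=> Pt Pu; elim: j => //= j; exact: Pt. Qed.

Lemma near_hex : near_hexagon r hex.
Proof.
have z : `|1 - 1| <= r by rewrite subrr normr0 ltW.
split; rewrite /= ?n10 ?n01// (_ : (0, 1) - (1, 0) = (-1, 1) :> pt) ?n11//.
by apply: injective_projections; rewrite /= ?sub0r ?subr0.
Qed.

Lemma turn_hex : turn hex = ((0, 1), (-1, 1)).
Proof. by rewrite /turn /=; congr (_, _); apply: injective_projections;
  rewrite /= ?sub0r ?subr0. Qed.

Lemma iter_close j u v : hexagon_close r u v ->
  hexagon_close r (iter j turn u) (iter j turn v).
Proof. by move=> uv; elim: j => //= j; exact: hexagon_close_turn. Qed.

Lemma iter_near j u : near_hexagon r u -> near_hexagon r (iter j turn u).
Proof. by move=> hu; apply: iter_turn hu => v; exact: near_hexagon_turn. Qed.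

Let c j := k (iter j turn hex).1.

Lemma c_next j : c j != c j.+1.
Proof. exact: near_hexagon_colors (iter_near j near_hex). Qed.

Lemma c_periodic j : c (j + 6) = c j.
Proof. by rewrite /c iterD turn6. Qed.

Lemma hexagon_color_turns j : c j != c j.+2.
Proof.
have q1 i : q (iter i turn (turn hex)) = q (iter i turn hex).
  rewrite turn_hex.
  apply: (hexagon_path r0 (I := fun u => q (iter i turn u) = q (iter i turn hex))) => //.
  move=> u v hu hv uv <-; apply/esym; apply: hexagon_phase_close.
  - exact: iter_near.
  - exact: iter_near.
  - exact: iter_close.
have qE i : q (iter i turn hex) = q hex.
  by elim: i => // i <-; rewrite iterSr q1.
(* The phase is the same on all six sides, so in the sum around the hexagon phases and potentials
   cancel and [six_walk] applies. *)
have qc i : cyc3 (c i) (c i.+1) = q hex (+) H (iter i turn hex).1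
    (+) H (iter i.+1 turn hex).1.
  rewrite -(qE i) /q /c /=; move: (cyc3 _ _) (H _) (H _); by do 3!case.
have := @six_walk (c 0) (c 1) (c 2) (c 3) (c 4) (c 5)
  (c_next 0) (c_next 1) (c_next 2) (c_next 3) (c_next 4).
have -> : c 0 = c 6 by rewrite -(c_periodic 0).
move=> /(_ (c_next 5)).
have -> : cyc3 (c 6) (c 1) = cyc3 (c 0) (c 1) by rewrite -(c_periodic 0).
rewrite !qc turn6 [iter 0 turn hex]/=.
move: (q hex) (H hex.1) (H (iter 1 turn hex).1) (H (iter 2 turn hex).1).
move: (H (iter 3 turn hex).1) (H (iter 4 turn hex).1) (H (iter 5 turn hex).1).
move=> b1 b2 b3 b4 b5 b6 b7 hw.
have {hw} : [&& c 6 != c 2, c 1 != c 3, c 2 != c 4, c 3 != c 5, c 4 != c 6 & c 5 != c 1].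
  by apply: hw; move: b1 b2 b3 b4 b5 b6 b7; do 7!case.
case/and5P=> h0 h1 h2 h3 /andP[h4 h5].
have cm i m : c (i + m * 6) = c i.
  by elim: m => [|m IH]; rewrite ?addn0// mulSn addnCA addnC c_periodic.
have -> : c j = c (j %% 6)%N by rewrite {1}(divn_eq j 6) addnC cm.
have -> : j.+2 = ((j %% 6).+2 + j %/ 6 * 6)%N.
  by rewrite {1}(divn_eq j 6) addnC -!addSn.
rewrite cm; have : (j %% 6 < 6)%N by rewrite ltn_mod.
case: (j %% 6)%N => [|[|[|[|[|[|]]]]]] //= _.
- by rewrite -(c_periodic 0).
- by rewrite (c_periodic 1).
Qed.

(* A potential for the color changes would force the colors of an inscribed
   hexagon to go round the three colors; then no vertex can change its color
   while the hexagon makes one turn. *)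
Lemma no_three_coloring_potential : False.
Proof.
suff e i : c i.+1 = c i by have := c_next 0; rewrite e eqxx.
suff : forall i, k (iter i turn (turn hex)).1 = c i.
  by move=> /(_ i); rewrite -iterSr.
rewrite turn_hex; apply: (hexagon_path r0 (I := fun u => forall i, k (iter i turn u).1 = c i)) => //.
move=> u v hu hv uv ku {}i.
have hi := iter_near i hu; have hvi := iter_near i hv.
have cl := iter_close i uv.
have p6 w : iter i turn w = turn (iter (i + 5) turn w).
  by rewrite -iterS -addnS iterD turn6.
rewrite -ku.
have e1 : k (iter i turn u).2 = c i.+1 by rewrite -ku.
(* The difference is the preceding vertex. The two neighbors of a vertex have different colors,
   which forces the color of the vertex. *)
have e5 : k ((iter i turn u).1 - (iter i turn u).2) = c (i + 5).
  rewrite -ku p6 /= opprB addrCA subrr addr0 //.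
have [cl1 _ _] := cl; have [a1 a2 a3] := hi; have [b1 _ _] := hvi.
apply: (@third_color_unique _ _ (c i.+1) (c (i + 5))).
- rewrite eq_sym -(c_periodic i.+1) (_ : i.+1 + 6 = (i + 5).+2)%N; last by lia.
  exact: hexagon_color_turns.
- by rewrite ku c_next.
- rewrite ku eq_sym -(c_periodic i) (_ : i + 6 = (i + 5).+1)%N; last by lia.
  exact: c_next.
- rewrite -e1; apply: kfar => //.
  by apply: unit_dist_perturb cl1; rewrite (plane_distC hn).
- rewrite -e5; apply: kfar => //; first by rewrite (plane_distC hn).
  apply: unit_dist_perturb cl1.
  by rewrite opprB addrCA subrr addr0.
Qed.

End ThreeColors.

End Hexagon.

(** * Parity on the triangular lattice *)

Section Parity.
Variable T : choiceType.
Implicit Types S : T -> bool.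

(* Junk value [false] when [S] holds infinitely often. *)
Definition parity S : bool := \big[addb/false]_(t \in [set: T]) S t.

Lemma eq_parity S S' : S =1 S' -> parity S = parity S'.
Proof. by move=> SS; apply: eq_fsbigr => t _. Qed.

Lemma parity_ex S : parity S -> exists t, S t.
Proof.
move=> pS; apply/not_existsP => S0.
by move: pS; rewrite /parity fsbig1// => t _; apply/negP => /S0.
Qed.

Lemma parity_supp (D : set T) S : [set t | S t] `<=` D ->
  parity S = \big[addb/false]_(t \in D) S t.
Proof.
move=> SD; apply/esym/fsbig_widen => //= t [_ nD].
by apply/negbTE/negP => /SD.
Qed.

Lemma parityD S S' : finite_set [set t | S t] -> finite_set [set t | S' t] ->
  parity (fun t => S t (+) S' t) = parity S (+) parity S'.
Proof.
move=> fS fS'; pose D := [set t | S t] `|` [set t | S' t].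
have DS : [set t | S t] `<=` D by exact: subsetUl.
have DS' : [set t | S' t] `<=` D by exact: subsetUr.
have DSS' : [set t | S t (+) S' t] `<=` D.
  by move=> t /=; case e: (S t) => h; [left|right].
rewrite (parity_supp DS) (parity_supp DS') (parity_supp DSS').
by rewrite fsbig_split// finite_setU.
Qed.

Lemma parity1 t0 : parity (fun t => t == t0).
Proof.
rewrite (@parity_supp [set t0]); first by rewrite fsbig_set1 eqxx.
by move=> t /= /eqP.
Qed.

Lemma parity_bij (f : T -> T) S : bijective f ->
  parity (fun t => S (f t)) = parity S.
Proof. by move=> bf; rewrite /parity [RHS](reindex_fsbigT f). Qed.

Lemma parity_pair (f : T -> T) S S' : bijective f ->
  finite_set [set t | S t] -> finite_set [set t | S' t] ->
  (forall t, S' t = S (f t)) -> parity (fun t => S t (+) S' t) = false.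
Proof.
move=> bf fS fS' SS'; rewrite parityD// (eq_parity SS').
by rewrite (parity_bij S bf) addbb.
Qed.

End Parity.

(* The plane is tiled by the triangles ((i, j), false), with vertices (i, j),
   (i+1, j), (i+1, j+1), and ((i, j), true), with vertices (i, j), (i, j+1),
   (i+1, j+1). *)
Notation lattice := (int * int)%type.
Notation tri := (int * int * bool)%type.

Definition vertex0 (t : tri) : lattice := t.1.
Definition vertex1 (t : tri) : lattice :=
  if t.2 then (t.1.1, t.1.2 + 1) else (t.1.1 + 1, t.1.2).
Definition vertex2 (t : tri) : lattice := (t.1.1 + 1, t.1.2 + 1).
Definition vertices (t : tri) : seq lattice := [:: vertex0 t; vertex1 t; vertex2 t].

(** The coboundary of the mod 2 cochain [g], evaluated on t. *)
Definition boundary (g : lattice -> lattice -> bool) (t : tri) :=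
  g (vertex0 t) (vertex1 t) (+) g (vertex1 t) (vertex2 t)
  (+) g (vertex0 t) (vertex2 t).

(** The neighbors across the horizontal, vertical and diagonal edge. Each flip exchanges the two
    kinds of triangles, so the pairings in [parity_boundary] have no fixed point. *)
Definition flip_h (t : tri) : tri :=
  if t.2 then ((t.1.1, t.1.2 + 1), false) else ((t.1.1, t.1.2 - 1), true).
Definition flip_v (t : tri) : tri :=
  if t.2 then ((t.1.1 - 1, t.1.2), false) else ((t.1.1 + 1, t.1.2), true).
Definition flip_d (t : tri) : tri := (t.1, ~~ t.2).

Lemma flip_bij : [/\ bijective flip_h, bijective flip_v & bijective flip_d].
Proof.
split.
- by apply: inv_bij; case=> [[i j] []]; rewrite /flip_h /= ?addrK ?subrK.
- by apply: inv_bij; case=> [[i j] []]; rewrite /flip_v /= ?addrK ?subrK.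
- by apply: inv_bij; case=> [[i j] []].
Qed.

Lemma finite_and (T : choiceType) (w s : T -> bool) :
  finite_set [set t | w t] -> finite_set [set t | w t && s t].
Proof. by apply: sub_finite_set => t /andP[]. Qed.

(* Mod 2 Stokes formula for a cochain that vanishes on the boundary of w: every
   edge on which g does not vanish is shared by two triangles of w. *)
Lemma parity_boundary (w : tri -> bool) (g : lattice -> lattice -> bool) :
  finite_set [set t | w t] -> (forall u v, g u v = g v u) ->
  (forall t t' u v, u \in vertices t -> v \in vertices t -> u \in vertices t' ->
     v \in vertices t' -> u != v -> g u v -> w t -> w t') ->
  parity (fun t => w t && boundary g t) = false.
Proof.
move=> fw gC gw.
have [bh bv bd] := flip_bij.
have gw2 t t' u v : u \in vertices t -> v \in vertices t -> u \in vertices t' ->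
    v \in vertices t' -> u != v -> w t && g u v = w t' && g u v.
  move=> ut vt ut' vt' uv; case guv : (g u v); rewrite ?andbF// !andbT.
  by apply/idP/idP; apply: gw guv.
pose h (t : tri) := if t.2 then g (vertex1 t) (vertex2 t) else g (vertex0 t) (vertex1 t).
pose v (t : tri) := if t.2 then g (vertex0 t) (vertex1 t) else g (vertex1 t) (vertex2 t).
pose d (t : tri) := g (vertex0 t) (vertex2 t).
have E t : w t && boundary g t = (w t && h t) (+) (w t && v t) (+) (w t && d t).
  rewrite /boundary /h /v /d; case: (w t) => //=; case: (t.2) => //.
  by rewrite [g (vertex0 t) _ (+) _]addbC.
have fhv : finite_set [set t | (w t && h t) (+) (w t && v t)].
  by apply: sub_finite_set fw => t /=; case: (w t).
rewrite (eq_parity E) parityD; [|exact: fhv|exact: finite_and].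
rewrite parityD; [|exact: finite_and|exact: finite_and].
have half (s : tri -> bool) (f : tri -> tri) : bijective f ->
    (forall t, w t && s t = w (f t) && s (f t)) ->
    (forall t, (f t).2 = ~~ t.2) -> parity (fun t => w t && s t) = false.
  move=> bf ws f2.
  rewrite (eq_parity (S' := fun t => (w t && (s t && t.2)) (+)
                                    (w t && (s t && ~~ t.2)))); last first.
    by move=> t; case: (w t); case: (s t); case: (t.2).
  apply: (parity_pair bf); [exact: finite_and|exact: finite_and|] => t.
  by rewrite f2 !andbA -ws.
have nz (i : int) : (i + 1 == i) = false by apply/negbTE; lia.
have nz' (i : int) : (i == i + 1) = false by apply/negbTE; lia.
have gw3 t t' x y : x \in vertices t -> y \in vertices t -> x \in vertices t' ->
    y \in vertices t' -> (x.1 != y.1) || (x.2 != y.2) ->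
    w t && g x y = w t' && g x y.
  move=> xt yt xt' yt' xy; apply: gw2 => //.
  by apply: contraTneq xy => ->; rewrite !eqxx.
rewrite (half h flip_h)//; last 2 first.
- case=> [[i j] []]; rewrite /h /vertex0 /vertex1 /vertex2 /flip_h /= ?subrK;
    by apply: gw3; rewrite /vertices /vertex0 /vertex1 /vertex2 ?inE /= ?subrK
      ?eqxx ?orbT ?nz'.
- by case=> [[i j] []].
rewrite (half v flip_v)//; last 2 first.
- case=> [[i j] []]; rewrite /v /vertex0 /vertex1 /vertex2 /flip_v /= ?subrK;
    by apply: gw3; rewrite /vertices /vertex0 /vertex1 /vertex2 ?inE /= ?subrK
      ?eqxx ?orbT ?nz' ?orbT.
- by case=> [[i j] []].
rewrite (half d flip_d)//.
by case=> [[i j] []]; rewrite /d /vertex0 /vertex2 /flip_d /=;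
  apply: gw3; rewrite /vertices /vertex0 /vertex1 /vertex2 ?inE /=
    ?eqxx ?orbT ?nz'.
Qed.

(** * Trichromatic triangles *)

Lemma dist1_between (R : realFieldType) (x y z d d' r : R) : x < 1 -> 1 <= y ->
  z <= d + x -> y <= d' + z -> d <= r -> d' <= r -> `|z - 1| <= r.
Proof. by move=> *; rewrite ler_norml; apply/andP; split; lra. Qed.

Lemma addb_boundary (a b c p q r x y z : bool) :
  (a (+) (p (+) q (+) x)) (+) (b (+) (q (+) r (+) y)) (+) (c (+) (p (+) r (+) z)) =
  (a (+) b (+) c) (+) (x (+) y (+) z).
Proof. by case: a; case: b; case: c; case: p; case: q; case: r; case: x; case: y; case: z. Qed.

Section Coloring.
Variable R : realType.
Let pt := (R^o * R^o)%type.
Variable n : pt -> R.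
Hypothesis hn : is_norm n.
Hypothesis n10 : n (1, 0) = 1.
Hypothesis n01 : n (0, 1) = 1.
Hypothesis n11 : n (-1, 1) = 1.
Variable eps : R.
Hypothesis eps0 : 0 < eps.
Hypothesis eps1 : eps <= 1 / 2.
Variable col : pt -> 'I_6.
Hypothesis hcol : forall x y, `|n (x - y) - 1| <= eps -> col x != col y.

(** Vertices of a triangle are at most 2 * mesh = eps / 4000 apart, the step that
    [annulus_potential] allows for eps / 2. *)
Definition mesh := eps / 8000.
Definition pos (u : lattice) : pt := (u.1%:~R * mesh, u.2%:~R * mesh).
Definition color (u : lattice) := col (pos u).
Definition cols (t : tri) := [seq color u | u <- vertices t].
Definition nearby (q : pt) (t : tri) := n (pos t.1 - q) < 1.

Lemma mesh_gt0 : 0 < mesh.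
Proof. by have e0 := eps0; rewrite /mesh; lra. Qed.

Lemma plane_norm_pair (a b : R) : n (a, b) <= `|a| + `|b|.
Proof. exact: plane_norm_le hn n10 n01 (a, b). Qed.

Lemma plane_pair_norm (a b : R) : `|a| <= 2 * n (a, b) /\ `|b| <= 2 * n (a, b).
Proof. exact: plane_norm_ge hn n10 n01 n11 (a, b). Qed.

Lemma vertices_dist t u v : u \in vertices t -> v \in vertices t ->
  n (pos u - pos v) <= eps / 4000.
Proof.
move=> ut vt.
have -> : pos u - pos v = ((u.1 - v.1)%:~R * mesh, (u.2 - v.2)%:~R * mesh).
  by rewrite !intrB !mulrBl.
apply: le_trans (plane_norm_pair _ _) _.
rewrite !(normrM _ mesh) (gtr0_norm mesh_gt0) -mulrDl -!intr_norm -intrD.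
have h : (`|u.1 - v.1| + `|u.2 - v.2| <= 2)%R.
  move: ut vt; case: t => [[i j] []]; rewrite /vertices /vertex0 /vertex1 /vertex2 !inE /=.
    by move=> /or3P[] /eqP-> /or3P[] /eqP-> /=; lia.
  by move=> /or3P[] /eqP-> /or3P[] /eqP-> /=; lia.
have : (`|u.1 - v.1| + `|u.2 - v.2|)%:~R * mesh <= 2%:~R * mesh.
  by rewrite ler_wpM2r ?ler_int// ltW// mesh_gt0.
by move=> /le_trans; apply; rewrite /mesh; lra.
Qed.

Lemma finite_ball (q : pt) (r : R) : finite_set [set t : tri | n (pos t.1 - q) <= r].
Proof.
have m0 := mesh_gt0.
pose B := Num.bound ((2 * r + `|q.1| + `|q.2|) / mesh).
pose f (x : 'I_(B + B).+1 * 'I_(B + B).+1 * bool) : tri :=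
  ((x.1.1 : nat)%:Z - B%:Z, (x.1.2 : nat)%:Z - B%:Z, x.2).
have bd (i : int) (c : R) : `|c| <= `|q.1| + `|q.2| -> `|i%:~R * mesh - c| <= 2 * r ->
    exists k : 'I_(B + B).+1, i = (k : nat)%:Z - B%:Z.
  move=> cq ic.
  have : `|i%:~R * mesh| <= 2 * r + `|q.1| + `|q.2|.
    by have := ler_normD (i%:~R * mesh - c) c; rewrite subrK; lra.
  rewrite (normrM _ mesh) (gtr0_norm m0) -ler_pdivlMr// => iB.
  have : `|i%:~R| < B%:R :> R.
    apply: (le_lt_trans iB); apply: archi_boundP; exact: le_trans (normr_ge0 _) iB.
  rewrite -intr_norm -[B%:R]/(B%:Z%:~R) ltr_int => iB'.
  have kB : (absz (i + B%:Z)%R < (B + B).+1)%N by lia.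
  by exists (Ordinal kB) => /=; lia.
have ff : finite_set (f @` [set: _]) by apply: finite_image; exact: finite_finset.
apply: (sub_finite_set _ ff) => -[[i j] b] /= h.
have [h1 h2] := plane_pair_norm (i%:~R * mesh - q.1) (j%:~R * mesh - q.2).
have hE : n (i%:~R * mesh - q.1, j%:~R * mesh - q.2) <= r by apply: le_trans h.
have [||k ki] := bd i q.1; [by rewrite lerDl|lra|].
have [||l lj] := bd j q.2; [by rewrite lerDr|lra|].
by exists (k, l, b) => //; rewrite /f /= ki lj.
Qed.

Lemma finite_near (q : pt) (s : tri -> bool) : finite_set [set t | nearby q t && s t].
Proof.
by apply: sub_finite_set (finite_ball q 1) => t /andP[/ltW].
Qed.

(* The point at distance 1 from both x and y would have no color. *)
Lemma colors_spread (x y : pt) :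
  (forall c, exists2 w, col w = c & n (w - x) <= eps \/ n (w - y) <= eps) ->
  2 < n (x - y).
Proof.
move=> hc; rewrite ltNge; apply/negP => xy.
have [z z1 zxy] : exists2 z, n z = 1 & n (z - (x - y)) = 1.
  have [xy0|xy0] := eqVneq (x - y) 0.
    apply: (@unit_circles_meet _ _ _ hn _ (1, 0)) => //; last by rewrite xy0 eqxx.
    by apply/eqP => -[/eqP]; rewrite oner_eq0.
  apply: (@unit_circles_meet _ _ _ hn _ (- (x - y).2, (x - y).1)) => //.
    apply: contra_neq xy0 => -[/eqP]; rewrite oppr_eq0 => /eqP h2 h1.
    exact: injective_projections.
  move: xy0 {xy}; move: (x - y) => [a b] ab0 _ s t [] /=.
  rewrite /GRing.scale /= => e1 e2.
  have ab : a * a + b * b != 0.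
    apply: contra_neq ab0 => /eqP; rewrite paddr_eq0 -?expr2 ?sqr_ge0// !sqrf_eq0.
    by move=> /andP[/eqP-> /eqP->].
  have s0 : s * (a * a + b * b) = (s * a + t * - b) * a + (s * b + t * a) * b.
    by ring.
  have t0 : t * (a * a + b * b) = (s * b + t * a) * a - (s * a + t * - b) * b.
    by ring.
  move: s0 t0; rewrite e1 e2 !mul0r addr0 subr0 => /eqP s0 /eqP t0.
  by move: s0 t0; rewrite !mulf_eq0 (negbTE ab) !orbF => /eqP-> /eqP->.
have zx : n (x - (x - z)) = 1 by rewrite opprB addrC subrK.
have zy : n (y - (x - z)) = 1.
  by rewrite -zxy; congr n; rewrite !opprB addrCA.
have [w wc hw] := hc (col (x - z)).
suff /hcol/eqP : `|n (w - (x - z)) - 1| <= eps by [].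
have cancel (u v c : pt) : u - c - (v - c) = u - v.
  by rewrite opprB addrA subrK.
by case: hw => hw; [rewrite -zx|rewrite -zy]; apply: le_trans (plane_lip hn _ _) _;
  rewrite cancel.
Qed.

Lemma all_colors (s : seq 'I_6) c : uniq s -> size s = 6 -> c \in s.
Proof.
move=> us s6; have := subset_cardP (A := mem s) (B := predT).
rewrite (card_uniqP us) s6 card_ord => /(_ erefl).
by move=> h; have := h (subset_predT _) c; rewrite !inE.
Qed.

Definition trichromatic (t : tri) := uniq (cols t).

Lemma cols_point c t : c \in cols t ->
  exists2 u, color u = c & forall v, v \in vertices t -> n (pos u - pos v) <= eps / 4000.
Proof. by move=> /mapP[u ut ->]; exists u => // v; exact: vertices_dist. Qed.

Lemma base_mem t : t.1 \in vertices t.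
Proof. by rewrite inE eqxx. Qed.

Lemma cols_avoid c t w : c \in cols t ->
  `|n (w - pos t.1) - 1| <= eps - eps / 4000 -> col w != c.
Proof.
move=> /cols_point[u <- ut] h; apply: hcol.
have := ut _ (base_mem t); have := plane_lip hn (w - pos u) (w - pos t.1).
rewrite (_ : w - pos u - _ = pos t.1 - pos u); last first.
  by rewrite opprB addrC addrA subrK.
rewrite (plane_distC hn (pos t.1)) => h1 h2.
have := ler_normD (n (w - pos u) - n (w - pos t.1)) (n (w - pos t.1) - 1).
by rewrite (_ : _ - _ + _ = n (w - pos u) - 1); [lra|ring].
Qed.

Lemma boundary_colors t :
  boundary (fun u v => color u != color v) t = trichromatic t.
Proof.
rewrite /boundary /trichromatic /cols /vertices /=.
move: (color (vertex0 t)) (color (vertex1 t)) (color (vertex2 t)) => a b c.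
rewrite !inE; case: (eqVneq a b) => [->|ab]; first by rewrite addNb; case: eqVneq.
case: (eqVneq b c) => [<-|bc]; first by rewrite ab.
by case: (eqVneq a c).
Qed.

(** * The annulus around a trichromatic triangle *)

Section Vertex.
Variables (p : tri) (a b c d e f : 'I_6).
Hypothesis uc : uniq [:: a; b; c; d; e; f].
Hypothesis ap : a \in cols p.
Hypothesis bp : b \in cols p.
Hypothesis cp : c \in cols p.
Let q0 := pos p.1.

Let k (x : pt) : option bool :=
  let z := col (q0 + x) in
  if z == d then None else if z == e then Some true else Some false.

Lemma ring_avoid x : `|n x - 1| <= eps / 2 ->
  [/\ col (q0 + x) != a, col (q0 + x) != b & col (q0 + x) != c].
Proof.
have ep0 := eps0 => h.
have h' : `|n (q0 + x - q0) - 1| <= eps - eps / 4000.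
  by rewrite [q0 + x]addrC addrK; apply: le_trans h _; lra.
by split; apply: cols_avoid h'.
Qed.

Lemma ring_code x y : `|n x - 1| <= eps / 2 -> `|n y - 1| <= eps / 2 ->
  (k x != k y) = (col (q0 + x) != col (q0 + y)).
Proof.
move=> /ring_avoid[xa xb xc] /ring_avoid[ya yb yc]; rewrite /k.
have := all_colors (col (q0 + x)) uc erefl.
have := all_colors (col (q0 + y)) uc erefl.
rewrite !inE (negbTE xa) (negbTE xb) (negbTE xc) (negbTE ya) (negbTE yb) (negbTE yc) /=.
have [de df ef] : [/\ d == e = false, d == f = false & e == f = false].
  move: uc; rewrite /= !inE !negb_or => /and5P[_ _ _ /andP[de df]].
  by rewrite andbT => ef; split; apply: negbTE.
have ed := de; rewrite eq_sym in ed; have fd := df; rewrite eq_sym in fd.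
have fe := ef; rewrite eq_sym in fe.
by move=> /or3P[] /eqP-> /or3P[] /eqP->; rewrite ?eqxx ?de ?df ?ef ?ed ?fd ?fe.
Qed.

Lemma ring_cocycle x y z : `|n x - 1| <= eps / 2 -> `|n y - 1| <= eps / 2 ->
  `|n z - 1| <= eps / 2 -> n (x - y) <= eps / 2 -> n (y - z) <= eps / 2 ->
  n (x - z) <= eps / 2 ->
  (col (q0 + x) != col (q0 + y)) (+) (col (q0 + y) != col (q0 + z))
  = (col (q0 + x) != col (q0 + z)).
Proof.
have ep0 := eps0; have ep1 := eps1 => x1 y1 z1 xy yz xz.
have [xa xb xc] := ring_avoid x1; have [ya yb yc] := ring_avoid y1.
have [za zb zc] := ring_avoid z1.
have [xyE|xyN] := eqVneq (col (q0 + x)) (col (q0 + y)).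
  by rewrite xyE.
have [yzE|yzN] := eqVneq (col (q0 + y)) (col (q0 + z)).
  by rewrite -yzE xyN.
have [//|xzN] := eqVneq (col (q0 + x)) (col (q0 + z)).
have us : uniq [:: a; b; c; col (q0 + x); col (q0 + y); col (q0 + z)].
  move: uc; rewrite /= !inE !negb_or => /and5P[/and5P[ab ac _ _ _] /and4P[bc _ _ _] _ _ _].
  by rewrite ab ac bc !(eq_sym a) !(eq_sym b) !(eq_sym c) xa xb xc ya yb yc za zb zc
    xyN yzN xzN.
have : 2 < n (q0 - (q0 + x)).
  have base u : u \in cols p -> exists2 w, col w = u &
      n (w - q0) <= eps \/ n (w - (q0 + x)) <= eps.
    move=> /cols_point[v <- vp]; exists (pos v) => //; left.
    by apply: le_trans (vp _ (base_mem p)) _; lra.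
  have ring w : n (x - w) <= eps / 2 -> exists2 v, col v = col (q0 + w) &
      n (v - q0) <= eps \/ n (v - (q0 + x)) <= eps.
    move=> xw; exists (q0 + w) => //; right.
    rewrite [q0 + w]addrC [q0 + x]addrC opprD addrACA subrr addr0.
    by rewrite (plane_distC hn); apply: le_trans xw _; lra.
  apply: colors_spread => u; have := all_colors u us erefl; rewrite !inE.
  case/or4P=> [/eqP->|/eqP->|/eqP->|/or3P[]/eqP->]; try exact: base.
  - by apply: ring; rewrite subrr (is_norm0 hn); lra.
  - exact: ring.
  - exact: ring.
rewrite opprD addrA subrr sub0r (is_normN hn).
by move: x1; rewrite ler_norml => /andP[? ?]; lra.
Qed.

Let lcut (u v : lattice) :=
  [&& u.2 < p.1.2, p.1.2 <= v.2 & v.1 < p.1.1]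
  || [&& v.2 < p.1.2, p.1.2 <= u.2 & u.1 < p.1.1].

Lemma lattice_cut u v : ray_cut (pos u - q0) (pos v - q0) = lcut u v.
Proof.
have m0 := mesh_gt0.
have E (i j : int) : (i%:~R * mesh - j%:~R * mesh < 0 :> R) = (i < j).
  by rewrite subr_lt0 ltr_pM2r// ltr_int.
have E' (i j : int) : (0 <= i%:~R * mesh - j%:~R * mesh :> R) = (j <= i).
  by rewrite subr_ge0 ler_pM2r// ler_int.
have ordE (x y : R^o * R^o) : ray_cut x y =
    [&& (x.2 : R) < 0, 0 <= (y.2 : R) & (y.1 : R) < 0]
    || [&& (y.2 : R) < 0, 0 <= (x.2 : R) & (x.1 : R) < 0] by [].
by rewrite ordE /= !E !E'.
Qed.

(** The lattice ray ends inside this triangle, whose last vertex is the base point of [p]. It is the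
    single triangle that makes the count in [trichromatic_near_odd] odd. *)
Lemma boundary_lcut t :
  boundary lcut t = (t == ((p.1.1 - 1, p.1.2 - 1), true)).
Proof.
rewrite /boundary /lcut /vertex0 /vertex1 /vertex2.
case: t p => [[i j] bb] [[i0 j0] b0] /=; rewrite !xpair_eqE.
case: bb => /=; case: (ltrP i i0) => ?; case: (ltrP j j0) => ?;
 case: (ltrP (i + 1) i0) => ?; case: (ltrP (j + 1) j0) => ?; rewrite /= ?andbF ?andbT;
 try lia.
Qed.

(* The circle of radius 1 around a trichromatic triangle has three colors only,
   and the number of changes of color along it is odd. *)
Lemma trichromatic_near_odd : parity (fun t => nearby q0 t && trichromatic t).
Proof.
have ep0 := eps0; have ep1 := eps1.
have e2 : 0 < eps / 2 by lra.
have e2' : eps / 2 <= 1 / 2 by lra.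
have [H [tau HE]] := annulus_potential hn n10 n01 n11 e2 e2'
  (g := fun x y => col (q0 + x) != col (q0 + y))
  (fun x y => congr1 negb (eq_sym _ _)) ring_cocycle.
have r0 : 0 < eps / 8000 by lra.
have l1 : eps / 8000 <= eps / 2 / 4 by lra.
have l2 : eps / 8000 <= eps / 2 / 2000 by lra.
have l3 : eps / 8000 <= eps / 2 by lra.
have l4 : 3 * (eps / 8000) <= eps by lra.
have l5 : eps / 4000 <= eps / 2 / 4 by lra.
have l6 : eps / 4000 <= eps / 2 / 2000 by lra.
have tau1 : tau.
  apply/negPn/negP => /negbTE tau0.
  apply: (no_three_coloring_potential hn n10 n01 n11 (k := k) (H := H) r0).
    move=> x y x1 y1 xy; rewrite (ring_code (le_trans x1 l3) (le_trans y1 l3)).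
    apply: hcol; rewrite [q0 + x]addrC [q0 + y]addrC opprD addrACA subrr addr0.
    exact: le_trans xy l4.
  move=> x y x1 y1 xy; rewrite (ring_code (le_trans x1 l3) (le_trans y1 l3)).
  by rewrite (HE _ _ (le_trans x1 l1) (le_trans y1 l1) (le_trans xy l2)) tau0 addbF.
(* As [tau] holds, this cochain vanishes on edges near the unit circle, so its coboundary has even
   sum inside. The color changes contribute the trichromatic triangles, the potential nothing, and
   the cut one triangle. *)
pose g u v := (color u != color v) (+) (H (pos u - q0) (+) H (pos v - q0) (+) lcut u v).
have gC u v : g u v = g v u.
  rewrite /g (eq_sym (color u)) (addbC (H (pos u - q0))); congr (_ (+) (_ (+) _)).
  by rewrite /lcut orbC.
have fn : finite_set [set t | nearby q0 t].
  by have := finite_near q0 xpredT; under eq_set do rewrite andbT.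
have := parity_boundary fn gC.
have -> : parity (fun t => nearby q0 t && boundary g t) =
    parity (fun t => (nearby q0 t && trichromatic t) (+)
                     (nearby q0 t && boundary lcut t)).
  apply: eq_parity => t; rewrite -boundary_colors -andb_addr; congr (_ && _).
  exact: addb_boundary.
rewrite parityD; [|exact: finite_near|exact: finite_near].
rewrite (@eq_parity _ (fun t => nearby q0 t && boundary lcut t)
  (fun t => t == ((p.1.1 - 1, p.1.2 - 1), true))); last first.
  move=> t; rewrite boundary_lcut; case: eqP => [->|]; rewrite ?andbF// andbT.
  rewrite /nearby /=; have -> : pos (p.1.1 - 1, p.1.2 - 1) - q0 = (- mesh, - mesh).
    by apply: injective_projections; rewrite /= intrB; ring.
  apply: le_lt_trans (plane_norm_pair _ _) _; rewrite normrN gtr0_norm ?mesh_gt0//.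
  by rewrite /mesh; lra.
rewrite parity1 addbT => h; apply/negbFE/h => t t' u v ut vt ut' vt' _ guv tn.
apply: contraTT guv => tn'.
have ann w : w \in vertices t -> w \in vertices t' ->
    `|n (pos w - q0) - 1| <= eps / 4000.
  move=> wt wt'; have d1 := vertices_dist wt (base_mem t).
  have d2 := vertices_dist (base_mem t') wt'.
  move: tn tn'; rewrite /nearby -leNgt => tn tn'.
  by apply: (dist1_between tn tn' _ _ d1 d2); exact: plane_dist.
have := ann u ut ut'; have := ann v vt vt'; have := vertices_dist ut vt.
move=> uv vn un; rewrite /g.
have := HE (pos u - q0) (pos v - q0).
rewrite (_ : pos u - q0 - _ = pos u - pos v); last by rewrite opprB addrA subrK.
rewrite lattice_cut tau1 andTb [q0 + _]addrC subrK [q0 + _]addrC subrK => hE.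
by rewrite (hE (le_trans un l5) (le_trans vn l5) (le_trans uv l6)) addbb.
Qed.

End Vertex.

End Coloring.

(** * Counting triangles by color triples *)

(** An argument [z_ijs] stands for [odd3 q i j s], with r and r' the two remaining colors. Each
    alternative prevents a path across edges of colors i, j from leading from a triangle of colors
    k, i, j to one of colors i, j, s; see [apex_door_absurd]. *)
Definition star (z_ijs z_krr z_ksr z_ijr' z_ksr' z_ijr : bool) :=
  [|| z_ijs, z_krr, ~~ z_ksr && z_ijr' | ~~ z_ksr' && z_ijr].
(* The variables are the parities [odd3] at a triangle of colors a, b, c. The
   equations define the others by means of [pair_sum0], given that the triple def
   does not occur; the first hypothesis contains the relations that are left. *)
Lemma boolean_core (abc abd abe acd ace bcd bce ade bde cde : bool) :
  let abf := abc (+) abd (+) abe in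
  let acf := abc (+) acd (+) ace in
  let bcf := abc (+) bcd (+) bce in
  let adf := abd (+) acd (+) ade in
  let aef := abe (+) ace (+) ade in
  let bdf := abd (+) bcd (+) bde in
  let bef := abe (+) bce (+) bde in
  let cdf := acd (+) bcd (+) cde in
  let cef := ace (+) bce (+) cde in
  [&& abf (+) acf (+) adf (+) aef == false, abf (+) bcf (+) bdf (+) bef == false,
      acf (+) bcf (+) cdf (+) cef == false &
      abc (+) abd (+) abe (+) abf (+) acd (+) ace (+) acf (+) bcd (+) bce (+) bcf
      (+) ade (+) adf (+) aef (+) bde (+) bdf (+) bef (+) cde (+) cdf (+) cef] ==>
  [&& ~~ (abd && cef), ~~ (abe && cdf), ~~ (abf && cde), ~~ (acd && bef),
      ~~ (ace && bdf), ~~ (acf && bde), ~~ (bcd && aef), ~~ (bce && adf) &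
      ~~ (bcf && ade)] ==>
  [&& ~~ abc,
   ([&& star bcd aef ade bcf adf bce, star bce adf ade bcf aef bcd & star bcf ade adf bce aef bcd]
    (+) [&& star acd bef bde acf bdf ace, star ace bdf bde acf bef acd & star acf bde bdf ace bef acd]
    (+) [&& star abd cef cde abf cdf abe, star abe cdf cde abf cef abd & star abf cde cdf abe cef abd]),
   ade (+) bde (+) cde, adf (+) bdf (+) cdf & aef (+) bef (+) cef].
Proof. by move: abc abd abe acd ace bcd bce ade bde cde; do 10!case. Qed.

(** Replaces colors by their positions in [s], so that identities between color triples are checked
    by computation in [index_triples]. *)
Lemma three_of_six (s : seq 'I_6) (c0 c1 c2 : 'I_6) : uniq s -> size s = 6%N ->
  exists i0 i1 i2 : nat, [/\ (i0 < 6)%N, (i1 < 6)%N, (i2 < 6)%N,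
    uniq [:: c0; c1; c2] = uniq [:: i0; i1; i2] &
    forall j, (j < 6)%N -> (nth c0 s j \in [:: c0; c1; c2]) = (j \in [:: i0; i1; i2])].
Proof.
move=> us s6; have hs c : c \in s by apply: all_colors.
exists (index c0 s), (index c1 s), (index c2 s).
have hl c : (index c s < 6)%N by rewrite -[X in (_ < X)%N]s6 index_mem.
have inj c c' : (index c s == index c' s) = (c == c').
  apply/eqP/eqP => [h|->//].
  by rewrite -(nth_index c (hs c)) -(nth_index c (hs c')) h.
split=> //; first by rewrite /= !inE !inj.
move=> j j6; have nj : j = index (nth c0 s j) s by rewrite index_uniq// s6.
by rewrite [in RHS]nj !inE !inj.
Qed.

Lemma uniq_reindex (T : eqType) (x0 : T) (s : seq T) (r : seq nat) : uniq s ->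
  uniq r && all (fun i => (i < size s)%N) r -> uniq [seq nth x0 s i | i <- r].
Proof.
move=> us /andP[ur /allP rs]; rewrite map_inj_in_uniq// => i j /rs si /rs sj /eqP.
by rewrite nth_uniq// => /eqP.
Qed.

Lemma addb_last (x y : bool) : x (+) y = false -> y = x.
Proof. by case: x; case: y. Qed.

Definition third_of_pair (i0 i1 i2 : nat) :=
  let m j := j \in [:: i0; i1; i2] in
  [&& m 0, m 1 & uniq [:: i0; i1; i2]] ==
  ([&& m 0, m 1 & m 2] (+) [&& m 0, m 1 & m 3] (+) [&& m 0, m 1 & m 4]
   (+) [&& m 0, m 1 & m 5])%N.

Definition some_triple (i0 i1 i2 : nat) :=
  let m i j k := [&& i \in [:: i0; i1; i2], j \in [:: i0; i1; i2] & k \in [:: i0; i1; i2]] in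
  (uniq [:: i0; i1; i2] ==
  (m 0 1 2 (+) m 0 1 3 (+) m 0 1 4 (+) m 0 1 5 (+) m 0 2 3 (+) m 0 2 4 (+) m 0 2 5
   (+) m 1 2 3 (+) m 1 2 4 (+) m 1 2 5 (+) m 0 3 4 (+) m 0 3 5 (+) m 0 4 5
   (+) m 1 3 4 (+) m 1 3 5 (+) m 1 4 5 (+) m 2 3 4 (+) m 2 3 5 (+) m 2 4 5
   (+) m 3 4 5))%N.

Lemma index_triples (i j k : nat) : (i < 6)%N -> (j < 6)%N -> (k < 6)%N ->
  third_of_pair i j k && some_triple i j k.
Proof.
have : all (fun i => all (fun j => all (fun k =>
    third_of_pair i j k && some_triple i j k) (iota 0 6)) (iota 0 6)) (iota 0 6).
  by vm_compute.
move=> /allP h i6 j6 k6.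
have hi := h i; rewrite mem_iota in hi; have /allP hj := hi i6.
have hji := hj j; rewrite mem_iota in hji; have /allP hk := hji j6.
by have := hk k; rewrite mem_iota; exact.
Qed.

Lemma third_color_parity (a b c d e f c0 c1 c2 : 'I_6) :
  uniq [:: a; b; c; d; e; f] -> let m x := x \in [:: c0; c1; c2] in
  [&& m a, m b & uniq [:: c0; c1; c2]] =
  [&& m a, m b & m c] (+) [&& m a, m b & m d] (+) [&& m a, m b & m e]
    (+) [&& m a, m b & m f].
Proof.
move=> us m; have [i0 [i1 [i2 [h0 h1 h2 uE mE]]]] := three_of_six c0 c1 c2 us erefl.
have /andP[/eqP + _] := index_triples h0 h1 h2; rewrite /m uE.
by rewrite -(mE 0%N)// -(mE 1%N)// -(mE 2%N)// -(mE 3%N)// -(mE 4%N)// -(mE 5%N).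
Qed.

Lemma uniq_triple_parity (a b c d e f c0 c1 c2 : 'I_6) :
  uniq [:: a; b; c; d; e; f] ->
  let m x y z := [&& x \in [:: c0; c1; c2], y \in [:: c0; c1; c2] & z \in [:: c0; c1; c2]] in
  uniq [:: c0; c1; c2] =
  m a b c (+) m a b d (+) m a b e (+) m a b f (+) m a c d (+) m a c e (+) m a c f
  (+) m b c d (+) m b c e (+) m b c f (+) m a d e (+) m a d f (+) m a e f
  (+) m b d e (+) m b d f (+) m b e f (+) m c d e (+) m c d f (+) m c e f
  (+) m d e f.
Proof.
move=> us m; have [i0 [i1 [i2 [h0 h1 h2 uE mE]]]] := three_of_six c0 c1 c2 us erefl.
have /andP[_ /eqP] := index_triples h0 h1 h2; rewrite /m uE.
by rewrite -(mE 0%N)// -(mE 1%N)// -(mE 2%N)// -(mE 3%N)// -(mE 4%N)// -(mE 5%N).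
Qed.

Lemma eq_pair_bool (T : eqType) (x y a b : T) :
  [|| a == x, a == y, b == x | b == y] ==>
  ((a == b) == ((a == x) && (b == x) || (a == y) && (b == y))).
Proof.
apply/implyP => h; apply/eqP; case: (eqVneq a b) h => [->|ab _].
  by case: (b == x); case: (b == y).
by apply/esym/norP; split; apply: contraNN ab => /andP[/eqP-> /eqP->].
Qed.

(** The propositional form of [boundary_edge]: [xa] says that the vertex a has color x, and [ab]
    that a and b have the same color. *)
Lemma edge_bool (xa ya xb yb xc yc ab ac bc : bool) :
  ~~ (xa && ya) -> ~~ (xb && yb) -> ~~ (xc && yc) ->
  [|| xa, ya, xb | yb] ==> (ab == (xa && xb || ya && yb)) ->
  [|| xa, ya, xc | yc] ==> (ac == (xa && xc || ya && yc)) ->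
  [|| xb, yb, xc | yc] ==> (bc == (xb && xc || yb && yc)) ->
  (xa && yb || ya && xb) (+) (xb && yc || yb && xc) (+) (xa && yc || ya && xc) =
  [&& [|| xa, xb | xc], [|| ya, yb | yc] & [&& ~~ (ab || ac), ~~ bc & true]].
Proof.
by case: xa; case: ya => //; case: xb; case: yb => //; case: xc; case: yc => //;
  case: ab; case: ac; case: bc.
Qed.

Lemma far_side (R : realFieldType) (a b c d d' r : R) : r < `|c - 1| ->
  `|a - c| <= d -> `|b - c| <= d' -> d <= r -> d' <= r -> (a < 1) = (b < 1).
Proof.
rewrite ltNge ler_norml negb_and -!ltNge !ler_norml.
move=> /orP h /andP[a1 a2] /andP[b1 b2] dr dr'.
by apply/idP/idP => ?; case: h => ?; lra.
Qed.

Lemma addb_square (p q r s x : bool) : p (+) q (+) x = false -> r (+) s (+) x = false ->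
  p (+) q = r (+) s.
Proof. by case: p; case: q; case: r; case: s; case: x. Qed.

(** The sums along adjacent rows differ by a strip of closed triangles and by its two vertical ends,
    where [g] vanishes; along the top row the sum is zero. *)
Lemma grid_cocycle (g : lattice -> lattice -> bool) (m : nat) :
  (forall t, boundary g t = false) ->
  (forall j : int, g (0, j) (0, j + 1) = false) ->
  (forall j : int, g (m%:Z, j) (m%:Z, j + 1) = false) ->
  (forall i : int, g (i, m%:Z) (i + 1, m%:Z) = false) ->
  \big[addb/false]_(i < m) g (i%:Z, 0) (i%:Z + 1, 0) = false.
Proof.
move=> g0 gl gr gt.
have strip (j : int) (k : nat) :
    (\big[addb/false]_(i < k) g (i%:Z, j) (i%:Z + 1, j)) (+) g (k%:Z, j) (k%:Z, j + 1) =
    \big[addb/false]_(i < k) g (i%:Z, j + 1) (i%:Z + 1, j + 1).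
  elim: k => [|k IH]; first by rewrite !big_ord0 gl.
  rewrite !big_ord_recr /= -IH -!addbA; congr (_ (+) _).
  rewrite -addn1 PoszD.
  exact: addb_square (g0 ((k%:Z, j), false)) (g0 ((k%:Z, j), true)).
have rows (j : nat) : \big[addb/false]_(i < m) g (i%:Z, 0) (i%:Z + 1, 0) =
    \big[addb/false]_(i < m) g (i%:Z, j%:Z) (i%:Z + 1, j%:Z).
  by elim: j => // j ->; rewrite -addn1 PoszD -strip gr addbF.
by rewrite (rows m) big1.
Qed.

(* Here [a] marks the first label and [~~ a && b] the second one. *)
Definition label_edge (a b a' b' : bool) := a && ~~ a' && b' || a' && ~~ a && b.

Lemma label_edge_degenerate (a0 b0 a1 b1 a2 b2 : bool) :
  [\/ a0 = a1 /\ b0 = b1, a0 = a2 /\ b0 = b2 | a1 = a2 /\ b1 = b2] ->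
  label_edge a0 b0 a1 b1 (+) label_edge a1 b1 a2 b2 (+) label_edge a0 b0 a2 b2 = false.
Proof.
by case=> -[-> ->]; [case: a1; case: b1; case: a2; case: b2|
  case: a1; case: b1; case: a2; case: b2|case: a0; case: b0; case: a2; case: b2].
Qed.

Section Triangles.
Variable R : realType.
Let pt := (R^o * R^o)%type.
Variable n : pt -> R.
Hypothesis hn : is_norm n.
Hypothesis n10 : n (1, 0) = 1.
Hypothesis n01 : n (0, 1) = 1.
Hypothesis n11 : n (-1, 1) = 1.
Variable eps : R.
Hypothesis eps0 : 0 < eps.
Hypothesis eps1 : eps <= 1 / 2.
Variable col : pt -> 'I_6.
Hypothesis hcol : forall x y, `|n (x - y) - 1| <= eps -> col x != col y.

Local Notation pos := (pos eps).
Local Notation color := (color eps col).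
Local Notation cols := (cols eps col).
Local Notation nearby := (nearby n eps).
Local Notation base t := (pos t.1).
Implicit Types (p t w : tri) (u v : lattice) (x y i j k : 'I_6) (q : pt).

Let vdist := vertices_dist hn n10 n01 eps0 eps1.

Definition has3 x y k t := [&& x \in cols t, y \in cols t & k \in cols t].
Definition near_parity q (h : tri -> bool) := parity (fun t => nearby q t && h t).
Definition odd3 q x y k : bool := near_parity q (has3 x y k).

Lemma near_parityD q h h' :
  near_parity q h (+) near_parity q h' = near_parity q (fun t => h t (+) h' t).
Proof.
rewrite /near_parity -parityD; [|exact: finite_near..].
by apply: eq_parity => t; rewrite andb_addr.
Qed.

Lemma eq_near_parity q h h' : h =1 h' -> near_parity q h = near_parity q h'.
Proof. by move=> hh; apply: eq_parity => t; rewrite hh. Qed.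

Lemma odd3A q x y k : odd3 q x y k = odd3 q y x k.
Proof. by apply: eq_near_parity => t; exact: andbCA. Qed.

Lemma odd3C q x y k : odd3 q x y k = odd3 q x k y.
Proof.
by apply: eq_near_parity => t; congr (_ && _); exact: andbC.
Qed.

Lemma odd3_rot q x y k : odd3 q x y k = odd3 q k x y.
Proof. by rewrite odd3C odd3A. Qed.

(** * Chains of triangles and monochromatic paths *)

Definition edge_colored x y (u v : lattice) :=
  (color u == x) && (color v == y) || (color u == y) && (color v == x).

Definition door x y t t' := exists u v,
  [/\ u \in vertices t, v \in vertices t, u \in vertices t', v \in vertices t' &
      color u = x /\ color v = y].

(** Such a path has vertices of color x on one side and of color y on the other; they keep it from
    crossing a unit circle around a point of color x or y. *)
Inductive door_path x y t : tri -> Prop :=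
| door_path0 : door_path x y t t
| door_pathS t' t'' : door_path x y t t' -> door x y t' t'' -> door_path x y t t''.

Inductive mono_path x (u : lattice) : lattice -> Prop :=
| mono0 : color u = x -> mono_path x u u
| monoS v v' : mono_path x u v -> color v' = x -> n (pos v - pos v') <= eps / 4000 ->
    mono_path x u v'.

Lemma door_sym x y t t' : door x y t t' -> door y x t t'.
Proof. by case=> u [v [ut vt ut' vt' [ux vy]]]; exists v, u. Qed.

(** A triangle with the colors x and y only has two edges of these colors, a trichromatic one that
    contains both has one. *)
Lemma boundary_edge x y t : x != y ->
  boundary (edge_colored x y) t = [&& x \in cols t, y \in cols t & trichromatic eps col t].
Proof.
move=> xy; rewrite /boundary /edge_colored /trichromatic /cols /vertices /=.
move: (color (vertex0 t)) (color (vertex1 t)) (color (vertex2 t)) => a b c.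
have no z : ~~ ((z == x) && (z == y)).
  by apply: contraNN xy => /andP[/eqP<- /eqP<-].
rewrite !inE !(eq_sym x) !(eq_sym y).
by apply: edge_bool => //; exact: eq_pair_bool.
Qed.

Lemma cols_vertex c t : c \in cols t -> exists2 u, u \in vertices t & color u = c.
Proof. by move=> /mapP[u ut ->]; exists u. Qed.

Lemma cl_cols u t : u \in vertices t -> color u \in cols t.
Proof. exact: map_f. Qed.

(** The vertex v has the color of q, so its distance to q differs from 1 by more than eps. Passing
    to the base points and moving the center changes it by less, so both triangles are on the same
    side. *)
Lemma nearby_step q q' t t' v : v \in vertices t -> v \in vertices t' ->
  color v = col q -> n (q - q') <= eps / 2 -> nearby q t = nearby q' t'.
Proof.
move=> vt vt' vq qq'; have ep0 := eps0.
have d := vdist (base_mem t) vt.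
have d' := vdist (base_mem t') vt'.
have far : eps < `|n (pos v - q) - 1|.
  by rewrite ltNge; apply/negP => /hcol; rewrite -/(color v) vq eqxx.
have h1 := plane_lip hn (base t - q) (pos v - q).
have h2 := plane_lip hn (base t' - q') (pos v - q).
have e1 : base t - q - (pos v - q) = base t - pos v by rewrite opprB addrA subrK.
have e2 : base t' - q' - (pos v - q) = (base t' - pos v) + (q - q').
  by apply: injective_projections => /=; ring.
rewrite e1 in h1; rewrite e2 in h2.
have h3 := is_norm_triangle hn (base t' - pos v) (q - q').
apply: (far_side far h1 h2); first by apply: le_trans d _; lra.
by apply: (le_trans h3); lra.
Qed.

Lemma nearby_base p t u : u \in vertices p -> color u \in cols t ->
  nearby (base p) t = nearby (pos u) t.
Proof.
move=> up /cols_vertex[v vt vu]; have ep0 := eps0; apply/esym.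
apply: (nearby_step vt vt) => //.
by apply: le_trans (vdist up (base_mem p)) _; lra.
Qed.

Lemma mono_cl c u v : mono_path c u v -> color v = c.
Proof. by case. Qed.

Lemma nearby_mono c u v t : mono_path c u v -> c \in cols t ->
  nearby (pos u) t = nearby (pos v) t.
Proof.
move=> uv ct; have ep0 := eps0; elim: uv => // v1 v2 uv1 -> _ d.
have [w wt wc] := cols_vertex ct.
apply: (nearby_step wt wt); last by apply: le_trans d _; lra.
by rewrite wc -(mono_cl uv1).
Qed.

Lemma nearbyC p t : nearby (base p) t = nearby (base t) p.
Proof. by rewrite /nearby plane_distC. Qed.

Lemma nearby_refl p : nearby (base p) p.
Proof. by rewrite /nearby subrr (is_norm0 hn) ltr01. Qed.

Lemma nearby_door q x y t t' : col q = x \/ col q = y -> door_path x y t t' ->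
  nearby q t = nearby q t'.
Proof.
have ep0 := eps0 => qxy; elim=> // t1 t2 _ -> [u [v [ut vt ut' vt' [ux vy]]]].
have qq : n (q - q) <= eps / 2 by rewrite subrr (is_norm0 hn); lra.
case: qxy => h; first by apply: (nearby_step ut ut'); rewrite // ux.
by apply: (nearby_step vt vt'); rewrite // vy.
Qed.

Lemma nearby_base_door p x y t t' : x \in cols p -> door_path x y t t' ->
  x \in cols t -> nearby (base p) t = nearby (base p) t'.
Proof.
move=> /cols_vertex[u up ux] tt' xt.
have xt' : x \in cols t'.
  by case: tt' => // t1 t2 _ [w [_ [_ _ wt _ [<- _]]]]; exact: cl_cols.
rewrite !(nearby_base up) ?ux//; apply: nearby_door tt'; by left.
Qed.

Lemma door_pathC x y t t' : door_path x y t t' -> door_path y x t t'.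
Proof.
elim=> [|t1 t2 _ h /door_sym d]; first exact: door_path0.
exact: door_pathS h d.
Qed.

Lemma has3_cols i j k t : i \in cols t -> j \in cols t -> k \in cols t -> has3 i j k t.
Proof. by rewrite /has3 => -> -> ->. Qed.

Lemma door_nearby_const x y i j k t t' w : door_path x y t t' ->
  x \in [:: i; j; k] \/ y \in [:: i; j; k] -> has3 i j k w ->
  nearby (base t) w = nearby (base t') w.
Proof.
have incols z : z \in [:: i; j; k] -> has3 i j k w -> z \in cols w.
  by move=> + /and3P[hi hj hk]; rewrite 3![in X in X -> _]inE => /or3P[]/eqP->.
move=> tt' xy ijk; elim: tt' => // t1 t2 _ -> [u [v [ut vt ut' vt' [ux vy]]]].
case: xy => /incols/(_ ijk) h; first by rewrite (nearby_base ut) ?ux// (nearby_base ut') ?ux.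
by rewrite (nearby_base vt) ?vy// (nearby_base vt') ?vy.
Qed.

(** Each counted triangle has the color x, or each has the color y, and every door has a vertex of
    that color; moving the center through the door changes no membership in the ball. *)
Lemma odd3_door x y i j k t t' : door_path x y t t' ->
  x \in [:: i; j; k] \/ y \in [:: i; j; k] -> odd3 (base t) i j k = odd3 (base t') i j k.
Proof.
move=> tt' xy; rewrite /odd3; apply: eq_parity => w.
by case h: (has3 i j k w); rewrite ?andbF// !andbT (door_nearby_const tt' xy h).
Qed.

Lemma odd3_nearby q i j k : odd3 q i j k -> exists2 t, nearby q t & has3 i j k t.
Proof. by move=> /parity_ex[t /andP[? ?]]; exists t. Qed.

Lemma has3_uniq i j k t : uniq [:: i; j; k] -> has3 i j k t ->
  trichromatic eps col t.
Proof.
move=> u /and3P[it jt kt]; apply: (leq_size_uniq u) => // z.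
by rewrite 3![in X in X -> _]inE => /or3P[] /eqP->.
Qed.

Lemma has3_disjoint i j k l m o t w : uniq [:: i; j; k; l; m; o] ->
  has3 i j k t -> has3 l m o w -> 2 < n (base t - base w).
Proof.
have ep0 := eps0; move=> u /and3P[it jt kt] /and3P[lw mw ow].
apply: (colors_spread hn hcol) => c.
have ct z : z \in cols t -> exists2 w', col w' = z &
    n (w' - base t) <= eps \/ n (w' - base w) <= eps.
  move=> /cols_vertex[v vt vz]; exists (pos v) => //; left.
  by apply: le_trans (vdist vt (base_mem t)) _; lra.
have cw z : z \in cols w -> exists2 w', col w' = z &
    n (w' - base t) <= eps \/ n (w' - base w) <= eps.
  move=> /cols_vertex[v vt vz]; exists (pos v) => //; right.
  by apply: le_trans (vdist vt (base_mem w)) _; lra.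
have := all_colors c u erefl; rewrite !inE.
by case/or4P=> [/eqP->|/eqP->|/eqP->|/or3P[]/eqP->]; [exact: ct|exact: ct|exact: ct|exact: cw..].
Qed.

Lemma not_both_near i j k l m o q t w : uniq [:: i; j; k; l; m; o] ->
  has3 i j k t -> has3 l m o w -> nearby q t -> nearby q w -> False.
Proof.
move=> u ht hw; have := has3_disjoint u ht hw; rewrite /nearby => h tq wq.
have := is_norm_triangle hn (base t - q) (q - base w).
by rewrite addrA subrK (plane_distC hn q); lra.
Qed.

Lemma odd3_exclusive q i j k l m o : uniq [:: i; j; k; l; m; o] ->
  ~~ (odd3 q i j k && odd3 q l m o).
Proof.
move=> u; apply/negP => /andP[/odd3_nearby[t tq ht] /odd3_nearby[w wq hw]].
exact: not_both_near u ht hw tq wq.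
Qed.

Lemma odd3_disjoint i j k l m o t w : uniq [:: i; j; k; l; m; o] ->
  has3 i j k t -> nearby (base w) t -> odd3 (base w) l m o = false.
Proof.
move=> u ht tw; apply/negP => /odd3_nearby[t' t'w h'].
exact: not_both_near u ht h' tw t'w.
Qed.

Lemma edgeC x y u v : edge_colored x y u v = edge_colored x y v u.
Proof. by rewrite /edge_colored orbC [X in X || _ = _]andbC [X in _ || X = _]andbC. Qed.

(* No edge of colors x, y crosses the unit circle around a point of color x. *)
Lemma pair_sum0 p x y k1 k2 k3 k4 : uniq [:: x; y; k1; k2; k3; k4] -> x \in cols p ->
  odd3 (base p) x y k1 (+) odd3 (base p) x y k2 (+) odd3 (base p) x y k3
    (+) odd3 (base p) x y k4 = false.
Proof.
move=> us xp; have xy : x != y by move: us => /=; rewrite inE negb_or => /andP[/andP[]].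
rewrite /odd3 !near_parityD.
have fn : finite_set [set t | nearby (base p) t].
  have := finite_near hn n10 n01 n11 eps0 eps1 (base p) xpredT.
  by under eq_set do rewrite andbT.
rewrite -(parity_boundary fn (edgeC x y)); last first.
  move=> t t' u v ut vt ut' vt' _ uvE; have [q0 q0p q0x] := cols_vertex xp.
  have h (w : lattice) : w \in vertices t -> w \in vertices t' -> color w = x ->
      nearby (base p) t -> nearby (base p) t'.
    move=> wt wt' wx; rewrite !(nearby_base q0p) ?q0x -?wx ?cl_cols//.
    rewrite (nearby_step wt wt' (q' := pos q0))//; first by rewrite wx.
    by rewrite subrr (is_norm0 hn); have := eps0; lra.
  by case/orP: uvE => /andP[/eqP ue /eqP ve]; [exact: (h u)|exact: (h v)].
apply: eq_near_parity => t; rewrite boundary_edge//.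
by rewrite /has3 -(third_color_parity _ _ _ us).
Qed.

Lemma total_odd p a b c d e f : uniq [:: a; b; c; d; e; f] -> has3 a b c p ->
  let z := odd3 (base p) in
  z a b c (+) z a b d (+) z a b e (+) z a b f (+) z a c d (+) z a c e (+) z a c f
  (+) z b c d (+) z b c e (+) z b c f (+) z a d e (+) z a d f (+) z a e f
  (+) z b d e (+) z b d f (+) z b e f (+) z c d e (+) z c d f (+) z c e f.
Proof.
move=> us abc; cbv zeta; have /and3P[ap bp cp] := abc.
have : near_parity (base p) (trichromatic eps col).
  exact: (trichromatic_near_odd hn n10 n01 n11 eps0 eps1 hcol us ap bp cp).
have zdef : odd3 (base p) d e f = false.
  by apply: (odd3_disjoint us abc); exact: nearby_refl.
rewrite (eq_near_parity _ (fun t => uniq_triple_parity _ _ _ us)) -!near_parityD.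
by rewrite -[X in _ (+) X]/(odd3 (base p) d e f) zdef addbF.
Qed.

(* At a triangle of colors k, i, j, [apex] distinguishes, an odd number of times,
   one of the three colors; [apex_door] shows that the condition is preserved by
   the paths that cross edges of colors i and j. *)
Definition apex q k i j l m o :=
  let F s r1 r2 := star (odd3 q i j s) (odd3 q k r1 r2) (odd3 q k s r1) (odd3 q i j r2)
    (odd3 q k s r2) (odd3 q i j r1) in
  [&& F l m o, F m l o & F o l m].

(** The hypotheses of [boolean_core] are [pair_sum0] for the twelve pairs that contain a color of p,
    and exclusion of complementary triples for the nine splittings other than abc, def. *)
Lemma abc_core p a b c d e f : uniq [:: a; b; c; d; e; f] -> has3 a b c p ->
  let z := odd3 (base p) in
  [/\ z a b c = false,
     apex (base p) a b c d e f (+) apex (base p) b a c d e f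
       (+) apex (base p) c a b d e f,
     z a d e (+) z b d e (+) z c d e, z a d f (+) z b d f (+) z c d f &
     z a e f (+) z b e f (+) z c e f].
Proof.
move=> us abc; cbv zeta; have /and3P[ap bp cp] := abc.
have zdef : odd3 (base p) d e f = false.
  by apply: (odd3_disjoint us abc); exact: nearby_refl.
pose q := base p; have pm r := uniq_reindex a us (r := r).
have Eab : odd3 q a b f = odd3 q a b c (+) odd3 q a b d (+) odd3 q a b e.
  by apply: addb_last; apply: pair_sum0.
have Eac : odd3 q a c f = odd3 q a b c (+) odd3 q a c d (+) odd3 q a c e.
  apply: addb_last; rewrite (odd3C _ a b c); apply: pair_sum0 ap.
  exact: (pm [:: 0; 2; 1; 3; 4; 5]%N).
have Ebc : odd3 q b c f = odd3 q a b c (+) odd3 q b c d (+) odd3 q b c e.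
  apply: addb_last; rewrite -(odd3_rot _ b c a); apply: pair_sum0 bp.
  exact: (pm [:: 1; 2; 0; 3; 4; 5]%N).
have Ead : odd3 q a d f = odd3 q a b d (+) odd3 q a c d (+) odd3 q a d e.
  apply: addb_last; rewrite (odd3C _ a b) (odd3C _ a c); apply: pair_sum0 ap.
  exact: (pm [:: 0; 3; 1; 2; 4; 5]%N).
have Eae : odd3 q a e f = odd3 q a b e (+) odd3 q a c e (+) odd3 q a d e.
  apply: addb_last; rewrite (odd3C _ a b) (odd3C _ a c) (odd3C _ a d); apply: pair_sum0 ap.
  exact: (pm [:: 0; 4; 1; 2; 3; 5]%N).
have Ebd : odd3 q b d f = odd3 q a b d (+) odd3 q b c d (+) odd3 q b d e.
  apply: addb_last; rewrite -(odd3_rot _ b d) (odd3C _ b c); apply: pair_sum0 bp.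
  exact: (pm [:: 1; 3; 0; 2; 4; 5]%N).
have Ebe : odd3 q b e f = odd3 q a b e (+) odd3 q b c e (+) odd3 q b d e.
  apply: addb_last; rewrite -(odd3_rot _ b e) (odd3C _ b c) (odd3C _ b d); apply: pair_sum0 bp.
  exact: (pm [:: 1; 4; 0; 2; 3; 5]%N).
have Ecd : odd3 q c d f = odd3 q a c d (+) odd3 q b c d (+) odd3 q c d e.
  apply: addb_last; rewrite -!(odd3_rot _ c d); apply: pair_sum0 cp.
  exact: (pm [:: 2; 3; 0; 1; 4; 5]%N).
have Ece : odd3 q c e f = odd3 q a c e (+) odd3 q b c e (+) odd3 q c d e.
  apply: addb_last; rewrite -!(odd3_rot _ c e) (odd3C _ c d); apply: pair_sum0 cp.
  exact: (pm [:: 2; 4; 0; 1; 3; 5]%N).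
have Eaf : odd3 q a b f (+) odd3 q a c f (+) odd3 q a d f (+) odd3 q a e f = false.
  rewrite (odd3C _ a b) (odd3C _ a c) (odd3C _ a d) (odd3C _ a e); apply: pair_sum0 ap.
  exact: (pm [:: 0; 5; 1; 2; 3; 4]%N).
have Ebf : odd3 q a b f (+) odd3 q b c f (+) odd3 q b d f (+) odd3 q b e f = false.
  rewrite -(odd3_rot _ b f) (odd3C _ b c) (odd3C _ b d) (odd3C _ b e); apply: pair_sum0 bp.
  exact: (pm [:: 1; 5; 0; 2; 3; 4]%N).
have Ecf : odd3 q a c f (+) odd3 q b c f (+) odd3 q c d f (+) odd3 q c e f = false.
  rewrite -!(odd3_rot _ c f) (odd3C _ c d) (odd3C _ c e); apply: pair_sum0 cp.
  exact: (pm [:: 2; 5; 0; 1; 3; 4]%N).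
have ex i j k l m o (r : seq nat) : [seq nth a [:: a; b; c; d; e; f] z | z <- r] =
    [:: i; j; k; l; m; o] -> uniq r && all (fun x : nat => (x < 6)%N) r ->
    ~~ (odd3 q i j k && odd3 q l m o).
  by move=> h hr; apply: odd3_exclusive; rewrite -h; exact: pm.
have := total_odd us abc; rewrite -/q; cbv zeta => tot.
have := @boolean_core (odd3 q a b c) (odd3 q a b d) (odd3 q a b e) (odd3 q a c d) (odd3 q a c e)
  (odd3 q b c d) (odd3 q b c e) (odd3 q a d e) (odd3 q b d e) (odd3 q c d e).
rewrite -Eab in tot; cbv zeta; rewrite -Eab -Eac -Ebc -Ead -Eae -Ebd -Ebe -Ecd -Ece.
rewrite Eaf Ebf Ecf tot !eqxx implyTb => /implyP.
have h1 := ex _ _ _ _ _ _ [:: 0; 1; 3; 2; 4; 5]%N erefl isT.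
have h2 := ex _ _ _ _ _ _ [:: 0; 1; 4; 2; 3; 5]%N erefl isT.
have h3 := ex _ _ _ _ _ _ [:: 0; 1; 5; 2; 3; 4]%N erefl isT.
have h4 := ex _ _ _ _ _ _ [:: 0; 2; 3; 1; 4; 5]%N erefl isT.
have h5 := ex _ _ _ _ _ _ [:: 0; 2; 4; 1; 3; 5]%N erefl isT.
have h6 := ex _ _ _ _ _ _ [:: 0; 2; 5; 1; 3; 4]%N erefl isT.
have h7 := ex _ _ _ _ _ _ [:: 1; 2; 3; 0; 4; 5]%N erefl isT.
have h8 := ex _ _ _ _ _ _ [:: 1; 2; 4; 0; 3; 5]%N erefl isT.
have h9 := ex _ _ _ _ _ _ [:: 1; 2; 5; 0; 3; 4]%N erefl isT.
rewrite h1 h2 h3 h4 h5 h6 h7 h8 h9 => /(_ isT)/and5P[/negbTE c1 c2 c3 c4 c5].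
split=> //; move: c2; rewrite /apex.
by rewrite (odd3C _ a e d) (odd3C _ a f d) (odd3C _ a f e) (odd3C _ b e d) (odd3C _ b f d) (odd3C _ b f e)
  (odd3C _ c e d) (odd3C _ c f d) (odd3C _ c f e).
Qed.

(** * Pairing of triangles along chains *)

Definition xy_face x y t := [&& x \in cols t, y \in cols t & trichromatic eps col t].

Lemma door_parity x y (S : tri -> bool) : x != y -> finite_set [set t | S t] ->
  (forall t t', S t -> door x y t t' -> S t') ->
  parity (fun t => S t && xy_face x y t) = false.
Proof.
move=> xy fS cS; rewrite -(parity_boundary fS (edgeC x y)); last first.
  move=> t t' u v ut vt ut' vt' _ /orP[/andP[/eqP ue /eqP ve]|/andP[/eqP ue /eqP ve]] St;
    apply: (cS t t' St); by [exists u, v|exists v, u].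
by apply: eq_parity => t; rewrite boundary_edge.
Qed.

Definition door_closure x y (X : tri -> bool) t : bool :=
  `[< exists2 v : tri, X v & door_path x y v t >].

Lemma door_closure_parity x y (X : tri -> bool) q r : x != y ->
  (forall t t', X t -> door_path x y t t' -> n (base t' - q) <= r) ->
  parity (fun t => door_closure x y X t && xy_face x y t) = false.
Proof.
move=> xy hX; apply: door_parity xy _ _.
  apply: sub_finite_set (finite_ball hn n10 n01 n11 eps0 eps1 q r).
  by move=> t /= /asboolP[v Xv]; exact: hX.
move=> t t' /asboolP[v Xv vt] d; apply/asboolP; exists v => //.
exact: door_pathS vt d.
Qed.

(** Since p has the color x, no chain of doors leaves its unit ball; the faces in the ball are
    therefore paired by the chains. *)
Lemma door_class_even x y (X : tri -> bool) p : x != y -> x \in cols p ->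
  (forall t, X t -> nearby (base p) t && xy_face x y t) ->
  (forall t t', X t -> door_path x y t t' -> nearby (base p) t' -> xy_face x y t' -> X t') ->
  parity X = false.
Proof.
move=> xy xp hX cX.
have near' t t' : X t -> door_path x y t t' -> nearby (base p) t'.
  by move=> /hX/andP[nt /and3P[xt _ _]] tt'; rewrite -(nearby_base_door xp tt').
rewrite -(@door_closure_parity x y X (base p) 1 xy); last first.
  by move=> t t' Xt /(near' _ _ Xt)/ltW.
apply: eq_parity => t; apply/idP/andP => [Xt|[/asboolP[v Xv vt] h]].
  have /andP[_ ->] := hX t Xt; split=> //; apply/asboolP; exists t => //.
  exact: door_path0.
exact: cX Xv vt (near' _ _ Xv vt) h.
Qed.

Lemma third_color x y k1 k2 k3 k4 t : uniq [:: x; y; k1; k2; k3; k4] ->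
  xy_face x y t -> exists2 s, s \in [:: k1; k2; k3; k4] & has3 x y s t.
Proof.
move=> us; rewrite /xy_face [X in is_true X](third_color_parity _ _ _ us).
rewrite -!/(has3 x y _ t).
case e1 : (has3 x y k1 t); first by exists k1; rewrite ?e1 ?inE ?eqxx.
case e2 : (has3 x y k2 t); first by exists k2; rewrite ?e2 ?inE ?eqxx ?orbT.
case e3 : (has3 x y k3 t); first by exists k3; rewrite ?e3 ?inE ?eqxx ?orbT.
by case e4 : (has3 x y k4 t); first by exists k4; rewrite ?e4 ?inE ?eqxx ?orbT.
Qed.

Lemma door_path_nearby x y t t' : x \in cols t -> door_path x y t t' ->
  nearby (base t) t'.
Proof. by move=> xt tt'; rewrite -(nearby_base_door xt tt' xt) nearby_refl. Qed.

(** If klm is even at v, then ilm and jlm have odd sum there, and also at t. At t, lmo is even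
    because v is near, so the relation for the pair l, m makes klm odd at t, which excludes the
    complementary ijo. *)
Lemma apex_door_absurd_aux k i j l m o (v t : tri) : uniq [:: k; i; j; l; m; o] ->
  has3 k i j v -> door_path i j v t -> has3 i j l t ->
  odd3 (base v) k l m = false -> odd3 (base v) i j o = false.
Proof.
move=> us kij vt ijl zv; have pm r := uniq_reindex k us (r := r).
have /and3P[kv iv jv] := kij; have /and3P[it jt lt] := ijl.
have [_ _ c3 _ _] := abc_core us kij.
have zlmo : odd3 (base t) l m o = false.
  by apply: (odd3_disjoint us kij); rewrite nearbyC; exact: door_path_nearby vt.
have e1 : odd3 (base t) l m i (+) odd3 (base t) l m j (+) odd3 (base t) l m k
    (+) odd3 (base t) l m o = false.
  by apply: pair_sum0 lt; exact: (pm [:: 3; 4; 1; 2; 0; 5]%N).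
have ilm : odd3 (base v) i l m = odd3 (base t) l m i.
  by rewrite -odd3_rot; apply: (odd3_door vt); left; rewrite !inE eqxx !orbT.
have jlm : odd3 (base v) j l m = odd3 (base t) l m j.
  by rewrite -odd3_rot; apply: (odd3_door vt); right; rewrite !inE eqxx !orbT.
have klm : odd3 (base t) k l m.
  move: c3 e1; rewrite zv ilm jlm zlmo (odd3_rot (base t) l m k).
  by case: (odd3 _ l m i); case: (odd3 _ l m j); case: (odd3 _ k l m).
have -> : odd3 (base v) i j o = odd3 (base t) i j o.
  by apply: (odd3_door vt); left; rewrite !inE eqxx.
have := odd3_exclusive (base t) (pm [:: 0; 3; 4; 1; 2; 5]%N isT).
by rewrite /= klm => /negbTE.
Qed.

(** The first two alternatives of [star] fail: ijl is even at t, hence at v, and kmo is excluded at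
    v by the complementary colors of t. The other two are excluded by [apex_door_absurd_aux], with m
    and o exchanged for the second. *)
Lemma apex_door_absurd k i j l m o (v t : tri) : uniq [:: k; i; j; l; m; o] ->
  has3 k i j v -> door_path i j v t -> has3 i j l t ->
  star (odd3 (base v) i j l) (odd3 (base v) k m o) (odd3 (base v) k l m) (odd3 (base v) i j o)
    (odd3 (base v) k l o) (odd3 (base v) i j m) -> False.
Proof.
move=> us kij vt ijl; have pm r := uniq_reindex k us (r := r).
have /and3P[kv iv jv] := kij; have /and3P[it jt lt] := ijl.
have pijl := pm [:: 1; 2; 3; 0; 4; 5]%N isT.
have -> : odd3 (base v) i j l = false.
  have -> : odd3 (base v) i j l = odd3 (base t) i j l.
    by apply: (odd3_door vt); left; rewrite !inE eqxx.
  by have [] := abc_core pijl ijl.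
have -> : odd3 (base v) k m o = false.
  by apply: (odd3_disjoint pijl ijl); exact: door_path_nearby vt.
have pm' := pm [:: 0; 1; 2; 3; 5; 4]%N isT.
rewrite /star /=; case/orP => /andP[/negbTE h].
  by rewrite (apex_door_absurd_aux us kij vt ijl h).
by rewrite (apex_door_absurd_aux pm' kij vt ijl h).
Qed.

Lemma apex_door k i j l m o (v t : tri) : uniq [:: k; i; j; l; m; o] ->
  has3 k i j v -> apex (base v) k i j l m o -> door_path i j v t -> xy_face i j t ->
  has3 k i j t && apex (base t) k i j l m o.
Proof.
move=> us kij ap vt ijt; have pm r := uniq_reindex k us (r := r).
have /and3P[a1 a2 a3] := ap.
have [s +] := third_color (pm [:: 1; 2; 0; 3; 4; 5]%N isT) ijt.
rewrite [X in is_true X]inE => /orP[/eqP->|+] hs; last first.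
  have pm' := pm [:: 0; 1; 2; 4; 3; 5]%N isT.
  have pm'' := pm [:: 0; 1; 2; 5; 3; 4]%N isT.
  rewrite !inE => /or3P[]/eqP sE; rewrite sE in hs.
  - by case: (apex_door_absurd us kij vt hs a1).
  - by case: (apex_door_absurd pm' kij vt hs a2).
  - by case: (apex_door_absurd pm'' kij vt hs a3).
have kijt : has3 k i j t by move: hs => /and3P[? ? ?]; exact: has3_cols.
rewrite kijt /=; have [_ _ v1 v2 v3] := abc_core us kij.
have [_ _ t1 t2 t3] := abc_core us kijt.
have E s' : odd3 (base t) i j s' = odd3 (base v) i j s'.
  by apply/esym/(odd3_door vt); left; rewrite !inE eqxx.
have Ei r r' : odd3 (base t) i r r' = odd3 (base v) i r r'.
  by apply/esym/(odd3_door vt); left; rewrite !inE eqxx.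
have Ej r r' : odd3 (base t) j r r' = odd3 (base v) j r r'.
  by apply/esym/(odd3_door vt); right; rewrite !inE eqxx.
have cancel (a b c a' : bool) : a (+) b (+) c -> a' (+) b (+) c -> a' = a.
  by case: a; case: b; case: c; case: a'.
(* The triple klm contains neither i nor j, so [odd3_door] does not apply; its parity is recovered
   from those of ilm and jlm by the odd sum in [abc_core]. *)
have klm : odd3 (base t) k l m = odd3 (base v) k l m.
  by move: t1; rewrite Ei Ej; exact: cancel v1.
have klo : odd3 (base t) k l o = odd3 (base v) k l o.
  by move: t2; rewrite Ei Ej; exact: cancel v2.
have kmo : odd3 (base t) k m o = odd3 (base v) k m o.
  by move: t3; rewrite Ei Ej; exact: cancel v3.
move: ap; rewrite /apex !E (odd3C (base v) k m l) (odd3C (base v) k o l) (odd3C (base v) k o m).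
by rewrite (odd3C (base t) k m l) (odd3C (base t) k o l) (odd3C (base t) k o m) klm klo kmo.
Qed.

Lemma door_mono x y t t' u u' : door_path x y t t' -> u \in vertices t -> color u = x ->
  u' \in vertices t' -> color u' = x -> mono_path x u u'.
Proof.
have same t1 v v' (w : lattice) : mono_path x w v -> v \in vertices t1 -> v' \in vertices t1 ->
    color v' = x -> mono_path x w v'.
  by move=> wv vt vt' v'x; apply: monoS wv v'x _; exact: vdist vt vt'.
move=> tt' ut ux; elim: tt' u' => [u' ut' u'x|t1 t2 _ IH [v [v' [vt1 _ vt2 _ [vx _]]]] u' u2 u'x].
  by apply: same ut ut' u'x; exact: mono0.
by apply: same vt2 u2 u'x; exact: IH.
Qed.

(* An odd number of the triangles of colors a, x, y near p have apex a. The paths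
   that start there and cross edges of colors x and y must leave the ball around
   p; but the ball around a point of color x or y cannot be left in this way, and
   for triangles with a vertex of color a it amounts to the ball around p. *)
Lemma lonely_vertex a x y l m o p u0 u (w : lattice) : uniq [:: a; x; y; l; m; o] ->
  u0 \in vertices p -> color u0 = a -> odd3 (base p) a x y ->
  mono_path a u0 u -> n (pos u - pos w) <= eps / 4000 -> color w != x /\ color w != y.
Proof.
move=> us u0p u0a zp u0u uw; have pm r := uniq_reindex a us (r := r).
have ap : a \in cols p by rewrite -u0a cl_cols.
pose X t := nearby (base p) t && has3 a x y t.
have axy : uniq [:: a; x; y] by exact: (pm [:: 0; 1; 2]%N).
have /and3P[ax ay xy] : [&& a != x, a != y & x != y].
  by move: axy; rewrite /= !inE negb_or andbT -andbA.
(* For an apex k other than a, the color a is on the doors, so the paths stay in the ball around p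
   and pair the triangles. *)
have even k i j : uniq [:: k; i; j; l; m; o] -> (forall t, has3 k i j t = has3 a x y t) ->
    a = i -> parity (fun t => X t && apex (base t) k i j l m o) = false.
  move=> uk kE ai; apply: (@door_class_even i j _ p).
  - by move: uk => /= /and3P[_ + _]; rewrite inE negb_or => /andP[].
  - by rewrite -ai.
  - move=> t /andP[/andP[-> ht] _] /=; move: (ht); rewrite -kE => /and3P[_ it jt].
    by rewrite /xy_face it jt (has3_uniq axy ht).
  move=> t t' /andP[/andP[_ ht] apt] tt' nt' ft'.
  have ht' : has3 k i j t by rewrite kE.
  have /andP[h1 h2] := apex_door uk ht' apt tt' ft'.
  by rewrite /X nt' -kE h1.
have ex : parity (fun t => X t && apex (base t) x a y l m o) = false.
  apply: even => //; first exact: (pm [:: 1; 0; 2; 3; 4; 5]%N).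
  by move=> t; rewrite /has3 andbCA.
have ey : parity (fun t => X t && apex (base t) y a x l m o) = false.
  apply: even => //; first exact: (pm [:: 2; 0; 1; 3; 4; 5]%N).
  by move=> t; rewrite /has3; do 3!case: (_ \in cols t).
have fX (h : tri -> bool) : finite_set [set t | X t && h t].
  by apply: finite_and; exact: finite_near.
have ea : parity (fun t => X t && apex (base t) a x y l m o).
  have : parity X by [].
  rewrite (@eq_parity _ X (fun t => X t && apex (base t) a x y l m o
    (+) X t && apex (base t) x a y l m o (+) X t && apex (base t) y a x l m o)).
    rewrite parityD; last 2 first.
    - by under eq_set do rewrite -andb_addr; exact: fX.
    - exact: fX.
    by rewrite ey addbF parityD ?ex ?addbF//; exact: fX.
  move=> t; rewrite -!andb_addr; case Xt : (X t) => //=; apply/esym.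
  by have /andP[_ ht] := Xt; have [] := abc_core us ht.
pose S t := door_closure x y (fun t => X t && apex (base t) a x y l m o) t && xy_face x y t.
have SE t : S t -> has3 a x y t && apex (base t) a x y l m o.
  move=> /andP[/asboolP[v /andP[/andP[_ hv] av] vt] ft].
  exact: apex_door us hv av vt ft.
have dist2 t : door_closure x y (fun t => X t && apex (base t) a x y l m o) t ->
    n (base t - base p) <= 2.
  move=> /asboolP[v /andP[/andP[nv /and3P[_ xv _]] _] vt].
  have := door_path_nearby xv vt; move: nv; rewrite /nearby => h1 h2.
  have := is_norm_triangle hn (base t - base v) (base v - base p).
  by rewrite addrA subrK; lra.
have evenS : parity S = false.
  apply: (@door_closure_parity x y _ (base p) 2 xy) => t t' Xt tt'.
  by apply: dist2; apply/asboolP; exists t.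
(* The set [S] is even, but its part near p is odd by [ea], so some path ends outside the ball
   around p. *)
have [t /andP[St nt]] : exists t, S t && ~~ nearby (base p) t.
  apply: parity_ex; move: evenS.
  rewrite (@eq_parity _ S (fun t => X t && apex (base t) a x y l m o
    (+) S t && ~~ nearby (base p) t)); last first.
    move=> t; case St : (S t).
      by rewrite /X; have /andP[-> ->] := SE t St; rewrite !andbT /=; case: nearby.
    rewrite /= addbF; apply/esym/negP => Xt; move/negP: St; apply; apply/andP; split.
      by apply/asboolP; exists t => //; exact: door_path0.
    move: Xt => /andP[/andP[_ ht] _]; have /and3P[_ xt yt] := ht.
    by rewrite /xy_face xt yt (has3_uniq axy ht).
  rewrite parityD//; first by rewrite ea addTb => /negbFE.
  apply: sub_finite_set (finite_ball hn n10 n01 n11 eps0 eps1 (base p) 2).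
  by move=> t /andP[/andP[/dist2]].
have /andP[/and3P[at_ _ _] _] := SE t St.
move: St => /andP[/asboolP[v /andP[/andP[nv /and3P[av xv yv]] _] vt] _].
have uwe : n (pos u - pos w) <= eps / 2 by apply: le_trans uw _; have := eps0; lra.
have no : ~ (color w = x \/ color w = y).
  move=> wxy; move/negP: nt; apply.
  have step z : a \in cols z -> nearby (base p) z = nearby (pos w) z.
    move=> az; rewrite (nearby_base u0p) ?u0a// (nearby_mono u0u az).
    have [c cz ca] := cols_vertex az; apply: (nearby_step cz cz) => //.
    by rewrite ca -(mono_cl u0u).
  by rewrite (step t at_) -(nearby_door wxy vt) -(step v av).
by split; apply/eqP => h; apply: no; [left|right].
Qed.

(** Otherwise [lonely_vertex] for the colors b and d forbids a vertex of color b next to the vertex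
    of color a in p, but p has one. *)
Lemma odd3_pair0 a b c d e f p : uniq [:: a; b; c; d; e; f] -> has3 a b c p ->
  odd3 (base p) a b d = false.
Proof.
move=> us abc; have pm r := uniq_reindex a us (r := r).
have /and3P[/cols_vertex[u up ua] /cols_vertex[w wp wb] _] := abc.
apply/negP => z; have := lonely_vertex (pm [:: 0; 1; 3; 2; 4; 5]%N isT)
  up ua z (mono0 ua) (vdist up wp).
by rewrite wb /= eqxx => -[].
Qed.

Lemma odd3_apex_indep a b c d e f p : uniq [:: a; b; c; d; e; f] -> has3 a b c p ->
  odd3 (base p) a d e = odd3 (base p) a d f.
Proof.
move=> us abc; have pm r := uniq_reindex a us (r := r).
have /and3P[ap bp cp] := abc.
have acb : has3 a c b p by rewrite /has3 ap bp cp.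
have := pair_sum0 (pm [:: 0; 3; 1; 2; 4; 5]%N isT) ap => /=.
rewrite (odd3C _ a d b) (odd3C _ a d c) (odd3_pair0 us abc).
rewrite (odd3_pair0 (pm [:: 0; 2; 1; 3; 4; 5]%N isT) acb) /=.
by case: (odd3 _ a d e); case: (odd3 _ a d f).
Qed.

Lemma isolated_vertex a b c d e f p u0 u (w : lattice) :
  uniq [:: a; b; c; d; e; f] -> has3 a b c p -> odd3 (base p) a d e ->
  u0 \in vertices p -> color u0 = a -> mono_path a u0 u -> n (pos u - pos w) <= eps / 4000 ->
  color w \notin [:: d; e; f].
Proof.
move=> us abc zp u0p u0a u0u uw; have pm r := uniq_reindex a us (r := r).
have zp' : odd3 (base p) a d f by rewrite -(odd3_apex_indep us abc).
have [/negbTE wd /negbTE we] :=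
  lonely_vertex (pm [:: 0; 3; 4; 1; 2; 5]%N isT) u0p u0a zp u0u uw.
have [_ /negbTE wf] :=
  lonely_vertex (pm [:: 0; 3; 5; 1; 2; 4]%N isT) u0p u0a zp' u0u uw.
by rewrite !inE wd we wf.
Qed.

(* At each triangle t of colors a, d, e near p, an odd number of k among a, d, e
   satisfy [odd3 (base t) k b c]. By [isolated_vertex] the paths that cross edges
   at the vertex of color k keep the colors a, d, e, so that every k contributes an
   even number of triangles. *)
Lemma odd3_apex0 a b c d e f p : uniq [:: a; b; c; d; e; f] -> has3 a b c p ->
  odd3 (base p) a d e = false.
Proof.
move=> us abc; have pm r := uniq_reindex a us (r := r).
have /and3P[ap _ _] := abc; apply/negP => zp.
pose X t := nearby (base p) t && has3 a d e t.
have even k j r : uniq [:: a; j; r; b; c; f] -> k = a \/ k = j ->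
    (forall t, has3 a j r t = has3 a d e t) ->
    parity (fun t => X t && odd3 (base t) k b c) = false.
  move=> ua kaj kE; have pa r' := uniq_reindex a ua (r := r').
  apply: (@door_class_even a j _ p) => //.
  - by move: ua => /=; rewrite inE negb_or => /andP[/andP[]].
  - move=> t /andP[/andP[-> ht] _]; rewrite -kE in ht.
    have /and3P[at_ jt _] := ht.
    by rewrite /xy_face at_ jt (has3_uniq (pa [:: 0; 1; 2]%N isT) ht).
  move=> t t' /andP[/andP[_ ht] zt] tt' nt' ft'; rewrite -kE in ht.
  have kin : a \in [:: k; b; c] \/ j \in [:: k; b; c].
    by case: kaj => ->; [left|right]; rewrite inE eqxx.
  rewrite /X nt' -kE -(odd3_door tt' kin) zt andbT /=.
  have [s + hs] := third_color ua ft'.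
  rewrite [X in is_true X]inE => /orP[/eqP sr|sbcf]; first by rewrite -sr.
  have /and3P[at' jt' /cols_vertex[w wt' ws]] := hs.
  have /and3P[at_ jt rt] := ht.
  have /cols_vertex[u0 u0t u0k] : k \in cols t by case: kaj => ->.
  have /cols_vertex[u ut' uk] : k \in cols t' by case: kaj => ->.
  have mk : mono_path k u0 u.
    case: kaj => kE'; rewrite kE' in u0k uk *; first exact: door_mono tt' _ _ _ _.
    exact: door_mono (door_pathC tt') _ _ _ _.
  have [i1 [i2 [uk' hk']]] : exists i1 i2, uniq [:: k; i1; i2; b; c; f] /\ has3 k i1 i2 t.
    case: kaj => kE'; rewrite kE'; first by exists j, r.
    by exists a, r; split; [exact: (pa [:: 1; 0; 2; 3; 4; 5]%N)|rewrite /has3 jt at_ rt].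
  have := isolated_vertex uk' hk' zt u0t u0k mk (vdist ut' wt').
  by rewrite ws sbcf.
have ea := even a d e (pm [:: 0; 3; 4; 1; 2; 5]%N isT) (or_introl erefl) (fun=> erefl).
have ed := even d d e (pm [:: 0; 3; 4; 1; 2; 5]%N isT) (or_intror erefl) (fun=> erefl).
have ee : parity (fun t => X t && odd3 (base t) e b c) = false.
  apply: (even e e d (pm [:: 0; 4; 3; 1; 2; 5]%N isT) (or_intror erefl)) => t.
  by rewrite /has3; do 3!case: (_ \in cols t).
have fX (h : tri -> bool) : finite_set [set t | X t && h t].
  by apply: finite_and; exact: finite_near.
have : parity X by [].
rewrite (@eq_parity _ X (fun t => X t && odd3 (base t) a b c
    (+) X t && odd3 (base t) d b c (+) X t && odd3 (base t) e b c)).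
  rewrite parityD; last 2 first.
  - by under eq_set do rewrite -andb_addr; exact: fX.
  - exact: fX.
  by rewrite ee addbF parityD ?ea ?ed//; exact: fX.
move=> t; rewrite -!andb_addr; case Xt : (X t) => //=; apply/esym.
have /andP[_ ht] := Xt.
by have [] := abc_core (pm [:: 0; 3; 4; 1; 2; 5]%N isT) ht.
Qed.

Lemma no_trichromatic p : ~~ trichromatic eps col p.
Proof.
apply/negP => trp.
have : (2 < #|[predC cols p]|)%N.
  have := cardC (mem (cols p)); rewrite card_ord (card_uniqP trp) => /eqP.
  by rewrite -[(6)%N]/(3 + 3)%N eqn_add2l => /eqP->.
move=> /card_gt2P[k1 [k2 [k3 [[k1p k2p k3p] [k12 k23 k31]]]]].
pose a := color (vertex0 p); pose b := color (vertex1 p); pose c := color (vertex2 p).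
have us : uniq [:: a; b; c; k1; k2; k3].
  rewrite -[X in uniq X]/(cols p ++ [:: k1; k2; k3]) cat_uniq.
  apply/and3P; split; first exact: trp.
    apply/hasPn => z; rewrite 3![in X in X -> _]inE.
    by case/or3P => /eqP->; [exact: k1p|exact: k2p|exact: k3p].
  by rewrite /= !inE negb_or k12 k23 (eq_sym k1) k31.
have pm r := uniq_reindex a us (r := r).
have abc : has3 a b c p by apply/and3P; split; apply: cl_cols; rewrite !inE eqxx ?orbT.
have [ap bp cp] := and3P abc.
(* The sum of the parities at a, b and c together with k1, k2 is odd, while each of them vanishes by
   [odd3_apex0]. *)
have [_ _ + _ _] := abc_core us abc.
rewrite (odd3_apex0 us abc) (odd3_apex0 (pm [:: 1; 0; 2; 3; 4; 5]%N isT) (has3_cols bp ap cp)).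
by rewrite (odd3_apex0 (pm [:: 2; 0; 1; 3; 4; 5]%N isT) (has3_cols cp ap bp)).
Qed.

(** * Monochromatic components and Sperner's lemma *)

Lemma mono_extent c u v : mono_path c u v -> color u = c ->
  `|u.1%:~R - v.1%:~R : R| * mesh eps < 2 /\ `|u.2%:~R - v.2%:~R : R| * mesh eps < 2.
Proof.
move=> uv uc; have m0 := mesh_gt0 eps0.
have : nearby (pos v) (u, false).
  rewrite -(nearby_mono uv); last by rewrite -uc cl_cols ?inE ?eqxx.
  by rewrite /nearby subrr (is_norm0 hn) ltr01.
rewrite /nearby /= => uv1.
have := plane_pair_norm hn n10 n01 n11 (u.1%:~R * mesh eps - v.1%:~R * mesh eps)
  (u.2%:~R * mesh eps - v.2%:~R * mesh eps).
rewrite -!mulrBl !(normrM _ (mesh eps)) (gtr0_norm m0) => -[h1 h2].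
have uv2 : 2 * n ((u.1%:~R - v.1%:~R) * mesh eps, (u.2%:~R - v.2%:~R) * mesh eps) < 2.
  by rewrite -[X in _ < X]mulr1 ltr_pM2l// !mulrBl.
by split; [exact: le_lt_trans h1 uv2|exact: le_lt_trans h2 uv2].
Qed.

Lemma mono_shift u v (w : lattice) : color u = color v -> n (pos u - pos v) <= eps / 4000 ->
  mono_path (color v) v w -> mono_path (color u) u w.
Proof.
move=> uv d; rewrite uv; elim=> [_|v1 v2 _ uv1 v2c d'].
  exact: monoS (mono0 uv) erefl d.
exact: monoS uv1 v2c d'.
Qed.

(* Sperner's lemma on a large square: the monochromatic components are small,
   those that meet the half-plane x1 <= 0 get the label 1, the other ones that
   meet x2 <= 0 the label 2, and some triangle meets three kinds of components. *)
Lemma no_six_coloring : False.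
Proof.
have m0 := mesh_gt0 eps0.
pose a u := `[< exists2 v, mono_path (color u) u v & v.1 <= 0 >].
pose b u := `[< exists2 v, mono_path (color u) u v & v.2 <= 0 >].
pose g u v := label_edge (a u) (b u) (a v) (b v).
have abE t u v : u \in vertices t -> v \in vertices t -> color u = color v ->
    a u = a v /\ b u = b v.
  move=> ut vt uv; have d := vdist ut vt; have d' := vdist vt ut.
  by split; apply/asboolP/asboolP => -[w h1 h2]; exists w => //; apply: mono_shift h1.
have closed t : boundary g t = false.
  have [v0 v1 v2] : [/\ vertex0 t \in vertices t, vertex1 t \in vertices t &
    vertex2 t \in vertices t] by split; rewrite !inE eqxx ?orbT.
  apply: label_edge_degenerate.
  have := no_trichromatic t; rewrite /trichromatic /cols /= !inE andbT negb_and.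
  rewrite !negbK -orbA => /or3P[]/eqP h.
  - by apply: Or31; exact: abE v0 v1 h.
  - by apply: Or32; exact: abE v0 v2 h.
  - by apply: Or33; exact: abE v1 v2 h.
(* The side of the square is at least 2, more than the extent of a component in either coordinate,
   so the right and top sides miss the labels 1 and 2 respectively. *)
pose W := Num.bound (2 / mesh eps).
have W2 : 2 <= W%:R * mesh eps.
  rewrite -ler_pdivrMr//; apply/ltW/archi_boundP.
  by rewrite divr_ge0 ?(ltW m0).
have far (i : int) : i <= 0 -> 2 <= `|W%:Z%:~R - i%:~R : R| * mesh eps.
  move=> i0; apply: (le_trans W2); rewrite ler_pM2r// -intrB -intr_norm.
  by rewrite -[W%:R]/(W%:Z%:~R) ler_int; lia.
have aT (j : int) : a (0, j) by apply/asboolP; exists (0, j) => //; exact: mono0.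
have bT (i : int) : b (i, 0) by apply/asboolP; exists (i, 0) => //; exact: mono0.
have aF (j : int) : a (W%:Z, j) = false.
  apply/asboolP => -[w /mono_extent/(_ erefl)[+ _] /far] /=.
  by rewrite ltNge => /negP.
have bF (i : int) : b (i, W%:Z) = false.
  apply/asboolP => -[w /mono_extent/(_ erefl)[_ +] /far] /=.
  by rewrite ltNge => /negP.
(* On the bottom side [b] holds, so an edge counts when [a] changes, and the sum telescopes. Between
   the corners [a] changes from true to false, which contradicts [grid_cocycle]. *)
have bottom (m : nat) : \big[addb/false]_(i < m) g (i%:Z, 0) (i%:Z + 1, 0) =
    a (0, 0) (+) a (m%:Z, 0).
  elim: m => [|m IH]; first by rewrite big_ord0 addbb.
  rewrite big_ord_recr /= IH -addn1 PoszD /g !bT.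
  by rewrite -addbA; congr (_ (+) _); move: (a (m%:Z, 0)) (a (m%:Z + 1, 0)); do 2!case.
have := bottom W; rewrite grid_cocycle// ?aT ?aF//.
- by move=> j; rewrite /g !aT.
- by move=> j; rewrite /g !aF.
- by move=> i; rewrite /g !bF /label_edge !andbF.
Qed.

End Triangles.

(** * Arbitrary norms on the plane *)

Lemma equilateral_basis (R : realType) (V : lmodType R) (N : V -> R) (q w : V) :
  is_norm N -> (forall s t : R, s *: q + t *: w = 0 -> s = 0 /\ t = 0) ->
  exists a b, [/\ N a = 1, N b = 1, N (b - a) = 1 &
    forall s t : R, s *: a + t *: b = 0 -> s = 0 /\ t = 0].
Proof.
move=> hN ind.
have q0 : q != 0.
  apply/eqP => q0; have [|/eqP] := ind 1 0; first by rewrite q0 scaler0 scale0r addr0.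
  by rewrite oner_eq0.
have w0 : w != 0.
  apply/eqP => w0; have [|_ /eqP] := ind 0 1; first by rewrite w0 scaler0 scale0r addr0.
  by rewrite oner_eq0.
have Nq := is_norm_gt0 hN q0; have Na := unit_of_norm hN Nq.
have indq (s t : R) : s *: unit_of N q + t *: w = 0 -> s = 0 /\ t = 0.
  rewrite scalerA => /ind[/eqP + ->]; rewrite mulf_eq0 invr_eq0 (gt_eqF Nq) orbF.
  by move=> /eqP.
have N2 : N (unit_of N q) <= 2 by rewrite Na; lra.
have [b Nb Nba] := unit_circles_meet hN w0 (fun=> indq) N2.
exists (unit_of N q), b; split => // s t st.
have [t0|t0] := eqVneq t 0.
  move: st; rewrite t0 scale0r addr0 => /(congr1 N).
  rewrite (is_norm_homogeneous hN) Na mulr1 (is_norm0 hN) => /eqP.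
  by rewrite normr_eq0 => /eqP.
(* A dependent b would be a multiple of the unit vector with [|r| = 1] and [|r - 1| = 1], which no
   real r satisfies. *)
pose r := - (s / t); have bE : b = r *: unit_of N q.
  apply: (scalerI t0); rewrite scalerA /r mulrN mulrC divfK// scaleNr.
  by apply/eqP; rewrite -addr_eq0 addrC st.
have r1 : `|r| = 1 by move: Nb; rewrite bE (is_norm_homogeneous hN) Na mulr1.
have r2 : `|r - 1| = 1.
  by move: Nba; rewrite bE -[X in _ - X]scale1r -scalerBl (is_norm_homogeneous hN) Na mulr1.
by move: r1 r2; case: (ger0P r) => _; case: (ger0P (r - 1)) => _; lra.
Qed.

Lemma six_colors_unit_distance (R : realType) (N : 'rV[R]_2 -> R) (eps : R)
    (phi : 'rV[R]_2 -> 'I_6) : is_norm N -> 0 < eps ->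
  exists x y, [/\ phi x = phi y, x <> y & 1 - eps <= N (x - y) <= 1 + eps].
Proof.
move=> hN e0; apply: contrapT => none.
have [a [b [Na Nb Nba ind]]] : exists a b : 'rV[R]_2, [/\ N a = 1, N b = 1,
    N (b - a) = 1 & forall s t : R, s *: a + t *: b = 0 -> s = 0 /\ t = 0].
  apply: (equilateral_basis (q := delta_mx 0 0) (w := delta_mx 0 1) hN) => s t st.
  have := congr1 (fun x : 'rV[R]_2 => x 0 0) st.
  have := congr1 (fun x : 'rV[R]_2 => x 0 1) st.
  by rewrite !mxE /= !mulr0 !mulr1 add0r addr0.
pose f (x : (R^o * R^o)%type) := (x.1 : R) *: a + (x.2 : R) *: b.
have fD x y : f (x + y) = f x + f y by rewrite /f /= !scalerDl addrACA.
have fZ c x : f (c *: x) = c *: f x by rewrite /f /= scalerDr !scalerA.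
have fB x y : f (x - y) = f x - f y by rewrite -scaleN1r fD fZ scaleN1r.
have hn : is_norm (N \o f).
  split => [x y|c x|x] /=.
  - by rewrite fD; exact: is_norm_triangle.
  - by rewrite fZ; exact: is_norm_homogeneous.
  - move=> /(is_norm_definite hN)/ind[x1 x2]; exact: injective_projections.
(* The minimum meets the bound 1 / 2 of [no_six_coloring]; it also keeps the distance positive, so
   that x and y are distinct even if the given interval contains 0. *)
have m0 : 0 < Num.min eps (1 / 2) by rewrite lt_min e0; lra.
have m1 : Num.min eps (1 / 2) <= 1 / 2 by rewrite ge_min lexx orbT.
apply: (no_six_coloring hn _ _ _ m0 m1 (col := phi \o f)).
- by rewrite /= /f /= scale1r scale0r addr0.
- by rewrite /= /f /= scale1r scale0r add0r.
- by rewrite /= /f /= scale1r scaleN1r addrC.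
move=> x y; rewrite /= fB ler_distl => /andP[h1 h2]; apply/eqP => pxy.
have h3 : Num.min eps (1 / 2) <= eps by rewrite ge_min lexx.
apply: none; exists (f x), (f y); split => //; last by apply/andP; split; lra.
by move=> xy; move: h1; rewrite xy subrr (is_norm0 hN); lra.
Qed.

Theorem theorem1p1 (R : realType) (N : 'rV[R]_2 -> R) (hN : is_norm N)
    (eps : R) (heps : 0 < eps) :
  ((7%:R : R)%:E <= chromatic_number N `[(1 - eps)%R, (1 + eps)%R] [set: 'rV[R]_2])%E /\
  (forall M : 'I_6 -> set 'rV[R]_2,
     trivIset [set: 'I_6] M -> \bigcup_i M i = [set: 'rV[R]_2] ->
     exists (i : 'I_6) (x y : 'rV[R]_2),
       [/\ M i x, M i y, x <> y & 1 - eps <= N (x - y) <= 1 + eps]).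
Proof.
split.
  apply: le_ereal_inf_tmp => _ [k [phi hphi] <-].
  rewrite lee_fin ler_nat ltnNge; apply/negP => k6.
  have [x [y [pxy _ xy]]] :=
    six_colors_unit_distance (fun x => widen_ord k6 (phi (to_setT x))) hN heps.
  apply: (hphi (to_setT x) (to_setT y)); first by rewrite /= in_itv.
  by apply/val_inj; have := congr1 (@nat_of_ord 6) pxy.
move=> M _ MT.
have /choice[phi phiM] x : exists i, M i x.
  have : (\bigcup_i M i) x by rewrite MT.
  by case=> i _; exists i.
have [x [y [pxy xy h]]] := six_colors_unit_distance phi hN heps.
by exists (phi x), x, y; split=> //; rewrite pxy.
Qed.
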